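(* Let $G$ be a finite group, let $\mathcal{C}=\bigoplus_{g\in G}\mathcal{C}_g$ be a (right) $G$-crossed braided fusion category, and let $(\lambda,\nu)$ be an associative $G$-crossed zesting datum of $\mathcal{C}$. Then the underlying abelian category of $\mathcal{C}$ also admits a monoidal structure whose tensor product is given on homogeneous objects $X_{g_1}\in\mathcal{C}_{g_1}$, $Y_{g_2}\in\mathcal{C}_{g_2}$ by $$X_{g_1}\overset{\lambda}{\otimes}Y_{g_2}=X_{g_1}\otimes Y_{g_2}\otimes\lambda(g_1,g_2)$$ (extended additively to all objects).
   Context: $\Bbbk$ is an algebraically closed field of characteristic zero; fusion categories are over $\Bbbk$. All gradings are faithful ($\mathcal{C}_g\neq0$ for all $g\in G$); $e$ is the identity of $G$. A (right) $G$-crossed braided fusion category is a fusion category $\mathcal{C}$ with: (i) a $G$-grading $\mathcal{C}=\bigoplus_{g}\mathcal{C}_g$ with $\mathcal{C}_g\otimes\mathcal{C}_h\subset\mathcal{C}_{gh}$; (ii) a right $G$-action, i.e. a monoidal functor $T:\underline{G^{op}}\to\underline{\mathrm{Aut}_\otimes(\mathcal{C})}$ with $T_h(\mathcal{C}_g)\subset\mathcal{C}_{h^{-1}gh}$; write $X^g=T_g(X)$, $f^g=T_g(f)$, with natural isomorphisms $(\mu_g)_{X,Y}:(X\otimes Y)^g\to X^g\otimes Y^g$ (tensorators) and $(\gamma_{g,h})_X:X^{gh}\to(X^g)^h$ (compositors); (iii) a $G$-braiding: natural isomorphisms $c_{X,Y}:X\otimes Y\to Y\otimes X^h$ for $X\in\mathcal{C}$,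 $Y\in\mathcal{C}_h$. With $\alpha$ the associator ($\alpha_{X,Y,Z}:(X\otimes Y)\otimes Z\to X\otimes(Y\otimes Z)$) and $h^g=g^{-1}hg$, the axioms are: (1) $\alpha_{X^g,Y^g,Z^g}((\mu_g)_{X,Y}\otimes\mathrm{id})(\mu_g)_{X\otimes Y,Z}=(\mathrm{id}\otimes(\mu_g)_{Y,Z})(\mu_g)_{X,Y\otimes Z}(\alpha_{X,Y,Z})^g$; (2) $((\gamma_{k,h})_X)^g(\gamma_{kh,g})_X=(\gamma_{h,g})_{X^k}(\gamma_{k,hg})_X$; (3) $((\gamma_{g,h})_X\otimes(\gamma_{g,h})_Y)(\mu_{gh})_{X,Y}=(\mu_h)_{X^g,Y^g}((\mu_g)_{X,Y})^h(\gamma_{g,h})_{X\otimes Y}$; (4) for $Y\in\mathcal{C}_h$: $(\mathrm{id}\otimes(\gamma_{h,g}^{-1})_X)(\mu_g)_{Y,X^h}(c_{X,Y})^g=(\mathrm{id}\otimes(\gamma_{g,h^g}^{-1})_X)c_{X^g,Y^g}(\mu_g)_{X,Y}$; (5) for $Z\in\mathcal{C}_k$: $\alpha_{Z,X^k,Y^k}(c_{X,Z}\otimes\mathrm{id})\alpha^{-1}_{X,Z,Y^k}(\mathrm{id}\otimes c_{Y,Z})\alpha_{X,Y,Z}=(\mathrm{id}_Z\otimes(\mu_k)_{X,Y})c_{X\otimes Y,Z}$; (6) for $Y\in\mathcal{C}_h$, $Z\in\mathcal{C}_k$: $\alpha_{Y,Z,(X^h)^k}(\mathrm{id}_{Y\otimes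 Z}\otimes(\gamma_{h,k})_X)c_{X,Y\otimes Z}\alpha_{X,Y,Z}=(\mathrm{id}_Y\otimes c_{X^h,Z})\alpha_{Y,X^h,Z}(c_{X,Y}\otimes\mathrm{id}_Z)$. An associative $G$-crossed zesting datum of $\mathcal{C}$ is a pair $(\lambda,\nu)$ where $\lambda:G\times G\to\mathrm{Inv}(\mathcal{C}_e)$ assigns invertible objects of $\mathcal{C}_e$ and is a normalized ($\lambda(e,g)=\lambda(g,e)=\mathbf 1$) 2-cocycle with respect to the $G$-action, and $$\nu_{g_1,g_2,g_3}:\lambda(g_1,g_2)^{g_3}\otimes\lambda(g_1g_2,g_3)\to\lambda(g_2,g_3)\otimes\lambda(g_1,g_2g_3)$$ are isomorphisms with $\nu_{g_1,e,g_2}=1$ such that, for all $g_1,g_2,g_3,g_4\in G$ (associators and action coherence isomorphisms suppressed), $$(\nu_{g_2,g_3,g_4}\otimes\mathrm{id}_{\lambda(g_1,g_2g_3g_4)})(\mathrm{id}_{\lambda(g_2,g_3)^{g_4}}\otimes\nu_{g_1,g_2g_3,g_4})((\nu_{g_1,g_2,g_3})^{g_4}\otimes\mathrm{id}_{\lambda(g_1g_2g_3,g_4)})$$ $$=(\mathrm{id}_{\lambda(g_3,g_4)}\otimes\nu_{g_1,g_2,g_3g_4})(c_{\lambda(g_1,g_2)^{g_3g_4},\lambda(g_3,g_4)}\otimes\mathrm{id}_{\lambda(g_1g_2,g_3g_4)})(\mathrm{id}_{\lambda(g_1,g_2)^{g_3g_4}}\otimes\nu_{g_1g_2,g_3,g_4}).$$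 *)

(* Defs.v *)
From mathcomp Require Import all_boot all_order all_algebra all_fingroup.

Set Implicit Arguments.
Unset Strict Implicit.
Unset Printing Implicit Defensive.

Import GRing.Theory.
Local Open Scope ring_scope.

Reserved Notation "g ∘ f" (at level 40, left associativity).
Reserved Notation "X ⊗ Y" (at level 35, right associativity).
Reserved Notation "f ⊗₁ g" (at level 35, right associativity).
Reserved Notation "f ⁻¹" (at level 1, format "f ⁻¹").

Record lincat (k : fieldType) := Lincat {
  ob :> Type;
  Mor : ob -> ob -> vectType k;
  idmor : forall X, Mor X X;
  mcomp : forall X Y Z, Mor Y Z -> Mor X Y -> Mor X Z;
  compA : forall X Y Z W (h : Mor Z W) (g : Mor Y Z) (f : Mor X Y),
    mcomp h (mcomp g f) = mcomp (mcomp h g) f;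
  comp1m : forall X Y (f : Mor X Y), mcomp (idmor Y) f = f;
  compm1 : forall X Y (f : Mor X Y), mcomp f (idmor X) = f;
  comp_linearl : forall X Y Z (a : k) (g g' : Mor Y Z) (f : Mor X Y),
    mcomp (a *: g + g') f = a *: mcomp g f + mcomp g' f;
  comp_linearr : forall X Y Z (a : k) (g : Mor Y Z) (f f' : Mor X Y),
    mcomp g (a *: f + f') = a *: mcomp g f + mcomp g f' }.

Arguments Mor {k C} X Y : rename.
Arguments idmor {k C} X : rename.
Arguments mcomp {k C X Y Z} g f : rename.

Notation "g ∘ f" := (mcomp g f) : ring_scope.

Record Iso (k : fieldType) (C : lincat k) (X Y : C) := MkIso {
  fwd :> Mor X Y;
  bwd : Mor Y X;
  fwdK : bwd ∘ fwd = idmor X;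
  bwdK : fwd ∘ bwd = idmor Y }.

Notation "f ⁻¹" := (bwd f) : ring_scope.

(* The identity morphism of X, seen as a morphism to a propositionally equal
   object; it is needed because, e.g., the group law of G is associative only
   up to a propositional equality. *)
Definition eqmor (k : fieldType) (C : lincat k) (X Y : C) (e : X = Y) :
    Mor X Y :=
  ecast Z (Mor X Z) e (idmor X).

Section AbelianCat.
Context {k : fieldType} {C : lincat k}.
Implicit Types X Y Z : C.

Definition isomorphic X Y : Prop := inhabited (Iso X Y).

Definition is_zero X : Prop :=
  (forall Y (f : Mor X Y), f = 0) /\ (forall Y (f : Mor Y X), f = 0).

Definition is_direct_sum (I : finType) (F : I -> C) (S : C) : Prop :=
  exists (inj : forall i, Mor (F i) S) (proj : forall i, Mor S (F i)),
    [/\ forall i, proj i ∘ inj i = idmor (F i),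
        forall i j, i != j -> proj j ∘ inj i = 0 &
        \sum_i inj i ∘ proj i = idmor S].

Definition is_mono X Y (f : Mor X Y) : Prop :=
  forall W (u v : Mor W X), f ∘ u = f ∘ v -> u = v.

Definition is_epi X Y (f : Mor X Y) : Prop :=
  forall W (u v : Mor Y W), u ∘ f = v ∘ f -> u = v.

Definition is_iso X Y (f : Mor X Y) : Prop :=
  exists2 g : Mor Y X, g ∘ f = idmor X & f ∘ g = idmor Y.

Definition is_kernel X Y K (f : Mor X Y) (i : Mor K X) : Prop :=
  f ∘ i = 0 /\
  forall W (u : Mor W X), f ∘ u = 0 -> exists! v : Mor W K, i ∘ v = u.

Definition is_cokernel X Y Q (f : Mor X Y) (p : Mor Y Q) : Prop :=
  p ∘ f = 0 /\
  forall W (u : Mor Y W), u ∘ f = 0 -> exists! v : Mor Q W, v ∘ p = u.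

Definition simple_ob X : Prop :=
  ~ is_zero X /\
  forall Y (i : Mor Y X), is_mono i -> is_zero Y \/ is_iso i.

End AbelianCat.

(* The zero object is the direct sum of the empty family. *)
Record abelian_cat (k : fieldType) (C : lincat k) : Prop := AbelianCat {
  ab_sum : forall (I : finType) (F : I -> C), exists S, is_direct_sum F S;
  ab_ker : forall (X Y : C) (f : Mor X Y),
    exists (K : C) (i : Mor K X), is_kernel f i;
  ab_coker : forall (X Y : C) (f : Mor X Y),
    exists (Q : C) (p : Mor Y Q), is_cokernel f p;
  ab_mono : forall (X Y : C) (f : Mor X Y), is_mono f ->
    exists (Z : C) (g : Mor Y Z), is_kernel g f;
  ab_epi : forall (X Y : C) (f : Mor X Y), is_epi f ->
    exists (Z : C) (g : Mor Z X), is_cokernel g f }.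

Definition semisimple (k : fieldType) (C : lincat k) : Prop :=
  forall X : C, exists (n : nat) (F : 'I_n -> C),
    (forall i, simple_ob (F i)) /\ is_direct_sum F X.

Definition finitely_many_simples (k : fieldType) (C : lincat k) : Prop :=
  exists (n : nat) (S : 'I_n -> C),
    forall X : C, simple_ob X -> exists i, isomorphic X (S i).

Record bifunctor (k : fieldType) (C : lincat k) := Bifunctor {
  tens : C -> C -> C;
  tensm : forall X X' Y Y' : C,
    Mor X X' -> Mor Y Y' -> Mor (tens X Y) (tens X' Y');
  tensm_id : forall X Y : C, tensm (idmor X) (idmor Y) = idmor (tens X Y);
  tensm_comp : forall (X X' X'' Y Y' Y'' : C)
      (f' : Mor X' X'') (f : Mor X X') (g' : Mor Y' Y'') (g : Mor Y Y'),
    tensm (f' ∘ f) (g' ∘ g) = tensm f' g' ∘ tensm f g }.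

Arguments tens {k C} b X Y : rename.
Arguments tensm {k C} b {X X' Y Y'} f g : rename.

Definition bilinear_tensor (k : fieldType) (C : lincat k) (B : bifunctor C) :
    Prop :=
  (forall (X X' Y Y' : C) (a : k) (f f' : Mor X X') (g : Mor Y Y'),
     tensm B (a *: f + f') g = a *: tensm B f g + tensm B f' g) /\
  (forall (X X' Y Y' : C) (a : k) (f : Mor X X') (g g' : Mor Y Y'),
     tensm B f (a *: g + g') = a *: tensm B f g + tensm B f g').

Record monoidal (k : fieldType) (C : lincat k) := Monoidal {
  tensor :> bifunctor C;
  unit_ob : C;
  assoc : forall X Y Z : C,
    Iso (tens tensor (tens tensor X Y) Z) (tens tensor X (tens tensor Y Z));
  lunit : forall X : C, Iso (tens tensor unit_ob X) X;
  runit : forall X : C, Iso (tens tensor X unit_ob) X;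
  assoc_nat : forall (X X' Y Y' Z Z' : C)
      (f : Mor X X') (g : Mor Y Y') (h : Mor Z Z'),
    assoc X' Y' Z' ∘ tensm tensor (tensm tensor f g) h
    = tensm tensor f (tensm tensor g h) ∘ assoc X Y Z;
  lunit_nat : forall (X X' : C) (f : Mor X X'),
    lunit X' ∘ tensm tensor (idmor unit_ob) f = f ∘ lunit X;
  runit_nat : forall (X X' : C) (f : Mor X X'),
    runit X' ∘ tensm tensor f (idmor unit_ob) = f ∘ runit X;
  pentagon : forall X Y Z W : C,
    tensm tensor (idmor X) (assoc Y Z W) ∘ assoc X (tens tensor Y Z) W
      ∘ tensm tensor (assoc X Y Z) (idmor W)
    = assoc X Y (tens tensor Z W) ∘ assoc (tens tensor X Y) Z W;
  triangle : forall X Y : C,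
    tensm tensor (idmor X) (lunit Y) ∘ assoc X unit_ob Y
    = tensm tensor (runit X) (idmor Y) }.

Arguments unit_ob {k C} M : rename.
Arguments assoc {k C} M X Y Z : rename.
Arguments lunit {k C} M X : rename.
Arguments runit {k C} M X : rename.

Section Fusion.
Context {k : fieldType} {C : lincat k} (M : monoidal C).
Local Notation "X ⊗ Y" := (tens M X Y).
Local Notation "f ⊗₁ g" := (tensm M f g).

Definition invertible (X : C) : Prop :=
  exists Y : C, isomorphic (X ⊗ Y) (unit_ob M) /\ isomorphic (Y ⊗ X) (unit_ob M).

Definition is_left_dual (X' X : C) : Prop :=
  exists (ev : Mor (X' ⊗ X) (unit_ob M)) (coev : Mor (unit_ob M) (X ⊗ X')),
    runit M X ∘ (idmor X ⊗₁ ev) ∘ assoc M X X' X ∘ (coev ⊗₁ idmor X)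
      ∘ (lunit M X)⁻¹ = idmor X /\
    lunit M X' ∘ (ev ⊗₁ idmor X') ∘ (assoc M X' X X')⁻¹ ∘ (idmor X' ⊗₁ coev)
      ∘ (runit M X')⁻¹ = idmor X'.

Definition rigid : Prop :=
  forall X : C, (exists X', is_left_dual X' X) /\ (exists X', is_left_dual X X').

Record fusion : Prop := Fusion {
  fus_abelian : abelian_cat C;
  fus_semisimple : semisimple C;
  fus_finite : finitely_many_simples C;
  fus_bilinear : bilinear_tensor M;
  fus_rigid : rigid;
  fus_unit : simple_ob (unit_ob M) }.

End Fusion.

(* A direct sum decomposition into full subcategories, each given by its class
   of objects [deg g].  That the components are additive and closed under
   direct summands follows from the first three axioms. *)
Record grading (k : fieldType) (G : finGroupType) (C : lincat k)
    (M : monoidal C) := Grading {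
  deg : G -> C -> Prop;
  deg_iso : forall g (X Y : C), Iso X Y -> deg g X -> deg g Y;
  deg_orth : forall g h (X Y : C), g != h -> deg g X -> deg h Y ->
    forall f : Mor X Y, f = 0;
  deg_sum : forall X : C, exists F : G -> C,
    (forall g, deg g (F g)) /\ is_direct_sum F X;
  deg_tens : forall g h (X Y : C), deg g X -> deg h Y ->
    deg (g * h)%g (tens M X Y);
  deg_faithful : forall g, exists2 X : C, deg g X & ~ is_zero X }.

Record linfunctor (k : fieldType) (C : lincat k) := Linfunctor {
  fob :> C -> C;
  fmap : forall X Y : C, Mor X Y -> Mor (fob X) (fob Y);
  fmap_id : forall X : C, fmap (idmor X) = idmor (fob X);
  fmap_comp : forall (X Y Z : C) (g : Mor Y Z) (f : Mor X Y),
    fmap (g ∘ f) = fmap g ∘ fmap f;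
  fmap_linear : forall (X Y : C) (a : k) (f g : Mor X Y),
    fmap (a *: f + g) = a *: fmap f + fmap g }.

Arguments fmap {k C} F {X Y} f : rename.

Section GCrossed.
Context {k : fieldType} {G : finGroupType} {C : lincat k} {M : monoidal C}.
Local Notation "X ⊗ Y" := (tens M X Y).
Local Notation "f ⊗₁ g" := (tensm M f g).
Local Notation "1" := (unit_ob M).

(* [ract T g X] is X^g.  The unit isomorphisms of each monoidal functor T_g
   ([mu0]) and of the monoidal functor T itself ([gam0]) are explicit, with
   their usual coherence axioms.  That each T_g is an equivalence follows from
   [gam] and [gam0]. *)
Record right_action (D : grading G M) := RightAction {
  ract : G -> linfunctor C;
  act_deg : forall g h (X : C), deg D g X -> deg D (g ^ h)%g (ract h X);
  mu : forall g (X Y : C), Iso (ract g (X ⊗ Y)) (ract g X ⊗ ract g Y);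
  mu0 : forall g, Iso (ract g 1) 1;
  gam : forall g h (X : C), Iso (ract (g * h)%g X) (ract h (ract g X));
  gam0 : forall X : C, Iso X (ract 1%g X);
  mu_nat : forall g (X X' Y Y' : C) (f : Mor X X') (f' : Mor Y Y'),
    mu g X' Y' ∘ fmap (ract g) (f ⊗₁ f')
    = (fmap (ract g) f ⊗₁ fmap (ract g) f') ∘ mu g X Y;
  gam_nat : forall g h (X X' : C) (f : Mor X X'),
    gam g h X' ∘ fmap (ract (g * h)%g) f
    = fmap (ract h) (fmap (ract g) f) ∘ gam g h X;
  gam0_nat : forall (X X' : C) (f : Mor X X'),
    gam0 X' ∘ f = fmap (ract 1%g) f ∘ gam0 X;
  mu_assoc : forall g (X Y Z : C),
    assoc M (ract g X) (ract g Y) (ract g Z)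
      ∘ (mu g X Y ⊗₁ idmor (ract g Z)) ∘ mu g (X ⊗ Y) Z
    = (idmor (ract g X) ⊗₁ mu g Y Z) ∘ mu g X (Y ⊗ Z)
      ∘ fmap (ract g) (assoc M X Y Z);
  mu_lunit : forall g (X : C),
    lunit M (ract g X) ∘ (mu0 g ⊗₁ idmor (ract g X)) ∘ mu g 1 X
    = fmap (ract g) (lunit M X);
  mu_runit : forall g (X : C),
    runit M (ract g X) ∘ (idmor (ract g X) ⊗₁ mu0 g) ∘ mu g X 1
    = fmap (ract g) (runit M X);
  gam_assoc : forall p h g (X : C),
    fmap (ract g) (gam p h X) ∘ gam (p * h)%g g X
    = gam h g (ract p X) ∘ gam p (h * g)%g X
      ∘ eqmor (congr1 (fun x => ract x X) (esym (mulgA p h g)));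
  gam_lunit : forall g (X : C),
    gam 1%g g X ∘ eqmor (congr1 (fun x => ract x X) (esym (mul1g g)))
    = fmap (ract g) (gam0 X);
  gam_runit : forall g (X : C),
    gam g 1%g X ∘ eqmor (congr1 (fun x => ract x X) (esym (mulg1 g)))
    = gam0 (ract g X);
  gam_mu : forall g h (X Y : C),
    (gam g h X ⊗₁ gam g h Y) ∘ mu (g * h)%g X Y
    = mu h (ract g X) (ract g Y) ∘ fmap (ract h) (mu g X Y) ∘ gam g h (X ⊗ Y);
  gam_mu0 : forall g h,
    mu0 h ∘ fmap (ract h) (mu0 g) ∘ gam g h 1 = mu0 (g * h)%g;
  gam0_mu : forall X Y : C,
    mu 1%g X Y ∘ gam0 (X ⊗ Y) = gam0 X ⊗₁ gam0 Y;
  gam0_mu0 : mu0 1%g ∘ gam0 1 = idmor 1 }.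

(* In [br_act] both composites end in Y^g ⊗ X^(hg), up to the equality
   h g = g h^g. *)
Record gbraiding (D : grading G M) (T : right_action D) := GBraiding {
  br : forall (X : C) h (Y : C), deg D h Y -> Iso (X ⊗ Y) (Y ⊗ ract T h X);
  br_nat : forall (X X' : C) h (Y Y' : C) (dY : deg D h Y) (dY' : deg D h Y')
      (f : Mor X X') (f' : Mor Y Y'),
    br X' dY' ∘ (f ⊗₁ f') = (f' ⊗₁ fmap (ract T h) f) ∘ br X dY;
  br_act : forall g (X : C) h (Y : C) (dY : deg D h Y),
    (idmor (ract T g Y) ⊗₁ (gam T h g X)⁻¹) ∘ mu T g Y (ract T h X)
      ∘ fmap (ract T g) (br X dY)
    = (idmor (ract T g Y) ⊗₁
         (eqmor (congr1 (fun x => ract T x X) (esym (conjgC h g)))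
          ∘ (gam T g (h ^ g)%g X)⁻¹))
      ∘ br (ract T g X) (act_deg T g dY) ∘ mu T g X Y;
  br_hexl : forall (X Y : C) p (Z : C) (dZ : deg D p Z),
    assoc M Z (ract T p X) (ract T p Y) ∘ (br X dZ ⊗₁ idmor (ract T p Y))
      ∘ (assoc M X Z (ract T p Y))⁻¹ ∘ (idmor X ⊗₁ br Y dZ) ∘ assoc M X Y Z
    = (idmor Z ⊗₁ mu T p X Y) ∘ br (X ⊗ Y) dZ;
  br_hexr : forall (X : C) h (Y : C) p (Z : C)
      (dY : deg D h Y) (dZ : deg D p Z),
    assoc M Y Z (ract T p (ract T h X)) ∘ (idmor (Y ⊗ Z) ⊗₁ gam T h p X)
      ∘ br X (deg_tens dY dZ) ∘ assoc M X Y Z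
    = (idmor Y ⊗₁ br (ract T h X) dZ) ∘ assoc M Y (ract T h X) Z
      ∘ (br X dY ⊗₁ idmor Z) }.

Arguments br {D T} c X {h Y} dY : rename.

(* [nu_norm] says that nu g1 e g2 is the canonical map induced by 1^g2 ≅ 1.
   [nu_cocycle] is the associativity constraint on nu with the suppressed
   coherence isomorphisms restored: both sides go from
     ((λ(g1,g2)^g3)^g4 ⊗ λ(g1g2,g3)^g4) ⊗ λ(g1g2g3,g4)
   to
     (λ(g3,g4) ⊗ λ(g2,g3g4)) ⊗ λ(g1,g2g3g4).
   The braiding with λ(g3,g4), which has degree e, ends in an object acted upon
   by e, hence the inverse of [gam0].  The cocycle condition on the isomorphism
   classes of λ is the existence of nu. *)
Record assoc_zesting_datum (D : grading G M) (T : right_action D)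
    (c : gbraiding T) := AssocZestingDatum {
  lam : G -> G -> C;
  lam_deg : forall g h, deg D 1%g (lam g h);
  lam_inv : forall g h, invertible M (lam g h);
  lam1g : forall g, lam 1%g g = 1;
  lamg1 : forall g, lam g 1%g = 1;
  nu : forall g1 g2 g3,
    Iso (ract T g3 (lam g1 g2) ⊗ lam (g1 * g2)%g g3)
        (lam g2 g3 ⊗ lam g1 (g2 * g3)%g);
  nu_norm : forall g1 g2,
    nu g1 1%g g2
    = (eqmor (esym (lam1g g2)) ⊗₁ eqmor (congr1 (lam g1) (esym (mul1g g2))))
      ∘ (mu0 T g2 ⊗₁ idmor (lam g1 g2))
      ∘ (fmap (ract T g2) (eqmor (lamg1 g1))
         ⊗₁ eqmor (congr1 (lam^~ g2) (mulg1 g1))) :> Mor _ _;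
  nu_cocycle : forall g1 g2 g3 g4,
    (nu g2 g3 g4
       ⊗₁ eqmor (congr1 (lam g1) (esym (mulgA g2 g3 g4))))
    ∘ (assoc M (ract T g4 (lam g2 g3)) (lam (g2 * g3)%g g4)
         (lam g1 (g2 * g3 * g4)%g))⁻¹
    ∘ (idmor (ract T g4 (lam g2 g3)) ⊗₁ nu g1 (g2 * g3)%g g4)
    ∘ assoc M (ract T g4 (lam g2 g3)) (ract T g4 (lam g1 (g2 * g3)%g))
        (lam (g1 * (g2 * g3))%g g4)
    ∘ ((mu T g4 (lam g2 g3) (lam g1 (g2 * g3)%g)
        ∘ fmap (ract T g4) (nu g1 g2 g3)
        ∘ (mu T g4 (ract T g3 (lam g1 g2)) (lam (g1 * g2)%g g3))⁻¹)
       ⊗₁ eqmor (congr1 (lam^~ g4) (esym (mulgA g1 g2 g3))))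
    = (assoc M (lam g3 g4) (lam g2 (g3 * g4)%g)
         (lam g1 (g2 * (g3 * g4))%g))⁻¹
    ∘ (idmor (lam g3 g4) ⊗₁ nu g1 g2 (g3 * g4)%g)
    ∘ assoc M (lam g3 g4) (ract T (g3 * g4)%g (lam g1 g2))
        (lam (g1 * g2)%g (g3 * g4)%g)
    ∘ (((idmor (lam g3 g4) ⊗₁ (gam0 T (ract T (g3 * g4)%g (lam g1 g2)))⁻¹)
        ∘ br c (ract T (g3 * g4)%g (lam g1 g2)) (lam_deg g3 g4))
       ⊗₁ idmor (lam (g1 * g2)%g (g3 * g4)%g))
    ∘ (assoc M (ract T (g3 * g4)%g (lam g1 g2)) (lam g3 g4)
         (lam (g1 * g2)%g (g3 * g4)%g))⁻¹
    ∘ ((gam T g3 g4 (lam g1 g2))⁻¹ ⊗₁ nu (g1 * g2)%g g3 g4)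
    ∘ assoc M (ract T g4 (ract T g3 (lam g1 g2)))
        (ract T g4 (lam (g1 * g2)%g g3)) (lam (g1 * g2 * g3)%g g4) }.

End GCrossed.

Arguments br {k G C M D T} c X {h Y} dY : rename.
Arguments lam {k G C M D T c} z g1 g2 : rename.

(* Main.v *)
(* For homogeneous objects, the associator of
     ((X ⊗ Y ⊗ λ(a,b)) ⊗ Z) ⊗ λ(ab,c)
   moves λ(a,b) past Z by the G-braiding and then applies ν.  Moving two such
   factors past an object and using the naturality of the braiding, the pentagon
   becomes the cocycle identity for ν.  The associators of C are removed from
   these computations by strictification: an object X is replaced by the functor
   X ⊗ -, and a morphism by the natural transformation that it induces.

   An arbitrary object is the direct sum of its homogeneous components, and
   X ⊗' Y is the direct sum of the products of the components of X and Y.  As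
   there are no morphisms between objects of different degrees, an iterated
   product is the direct sum of the iterated products of components, and the
   coherence axioms can be checked on these summands. *)

Require Import Defs.
From mathcomp Require Import all_boot all_order all_algebra all_fingroup.
From Stdlib Require Import ClassicalEpsilon.
Import Defs.

Set Implicit Arguments.
Unset Strict Implicit.
Unset Printing Implicit Defensive.

Import GRing.Theory.
Local Open Scope ring_scope.

(** * Isomorphisms *)

Section IsoCombinators.
Context {k : fieldType} {C : lincat k}.
Implicit Types X Y Z : C.

Lemma mcompA X Y Z W (h : Mor Z W) (g : Mor Y Z) (f : Mor X Y) :
  h ∘ g ∘ f = h ∘ (g ∘ f).
Proof. by rewrite compA. Qed.

Definition iso_id X : Iso X X :=
  MkIso (comp1m (idmor X)) (comp1m (idmor X)).

Lemma iso_comp_proof X Y Z (g : Iso Y Z) (f : Iso X Y) :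
  (f⁻¹ ∘ g⁻¹) ∘ (g ∘ f) = idmor X /\ (g ∘ f) ∘ (f⁻¹ ∘ g⁻¹) = idmor Z.
Proof.
by rewrite !mcompA (compA g⁻¹) fwdK comp1m fwdK (compA f) bwdK comp1m bwdK.
Qed.

Definition iso_comp X Y Z (g : Iso Y Z) (f : Iso X Y) : Iso X Z :=
  MkIso (proj1 (iso_comp_proof g f)) (proj2 (iso_comp_proof g f)).

Definition iso_inv X Y (f : Iso X Y) : Iso Y X := MkIso (bwdK f) (fwdK f).

Lemma iso_cancel_r X Y Z (f : Iso X Y) (g h : Mor Y Z) :
  g ∘ f = h ∘ f -> g = h.
Proof.
by move=> /(congr1 (fun u => u ∘ f⁻¹)); rewrite !mcompA bwdK !compm1.
Qed.

Lemma iso_cancel_l X Y Z (f : Iso Y Z) (g h : Mor X Y) :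
  f ∘ g = f ∘ h -> g = h.
Proof.
by move=> /(congr1 (fun u => f⁻¹ ∘ u)); rewrite !compA fwdK !comp1m.
Qed.

Lemma comp_bwdK X Y Z (f : Iso X Y) (g : Mor Z Y) : f ∘ (f⁻¹ ∘ g) = g.
Proof. by rewrite compA bwdK comp1m. Qed.

Lemma eqmor_esymK X Y (e : X = Y) : eqmor (esym e) ∘ eqmor e = idmor X.
Proof. by case: Y / e; rewrite comp1m. Qed.

Lemma eqmorK_esym X Y (e : X = Y) : eqmor e ∘ eqmor (esym e) = idmor Y.
Proof. by case: Y / e; rewrite comp1m. Qed.

Lemma eqmor_congr1K (I : Type) (F : I -> C) i j (e : i = j) :
  eqmor (congr1 F (esym e)) ∘ eqmor (congr1 F e) = idmor (F i).
Proof. by case: j / e; rewrite comp1m. Qed.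

Definition iso_eq X Y (e : X = Y) : Iso X Y :=
  MkIso (eqmor_esymK e) (eqmorK_esym e).

End IsoCombinators.

(** * Strictification *)

Section Flattening.
Context {k : fieldType} {C : lincat k} (M : monoidal C).
Local Notation "X ⊗ Y" := (tens M X Y).
Local Notation "f ⊗₁ g" := (tensm M f g).
Local Notation "1" := (unit_ob M).
Implicit Types X Y Z W : C.

Lemma iso_tens_proof X X' Y Y' (f : Iso X X') (g : Iso Y Y') :
  (f⁻¹ ⊗₁ g⁻¹) ∘ (f ⊗₁ g) = idmor (X ⊗ Y) /\
  (f ⊗₁ g) ∘ (f⁻¹ ⊗₁ g⁻¹) = idmor (X' ⊗ Y').
Proof. by rewrite -!tensm_comp !fwdK !bwdK !tensm_id. Qed.

Definition iso_tens X X' Y Y' (f : Iso X X') (g : Iso Y Y') :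
    Iso (X ⊗ Y) (X' ⊗ Y') :=
  MkIso (proj1 (iso_tens_proof f g)) (proj2 (iso_tens_proof f g)).

Lemma tensm1_comp X Y Y' Y'' (g : Mor Y' Y'') (f : Mor Y Y') :
  idmor X ⊗₁ (g ∘ f) = (idmor X ⊗₁ g) ∘ (idmor X ⊗₁ f).
Proof. by rewrite -tensm_comp comp1m. Qed.

Lemma tens1m_comp X Y Y' Y'' (g : Mor Y' Y'') (f : Mor Y Y') :
  (g ∘ f) ⊗₁ idmor X = (g ⊗₁ idmor X) ∘ (f ⊗₁ idmor X).
Proof. by rewrite -tensm_comp comp1m. Qed.

Lemma tensm_lr X X' Y Y' (f : Mor X X') (g : Mor Y Y') :
  f ⊗₁ g = (f ⊗₁ idmor Y') ∘ (idmor X ⊗₁ g).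
Proof. by rewrite -tensm_comp comp1m compm1. Qed.

Lemma tensm1_inj X Y (f g : Mor X Y) : f ⊗₁ idmor 1 = g ⊗₁ idmor 1 -> f = g.
Proof.
move=> /(congr1 (fun u => runit M Y ∘ u)); rewrite !runit_nat.
exact: iso_cancel_r.
Qed.

Lemma tens1m_inj X Y (f g : Mor X Y) : idmor 1 ⊗₁ f = idmor 1 ⊗₁ g -> f = g.
Proof.
move=> /(congr1 (fun u => lunit M Y ∘ u)); rewrite !lunit_nat.
exact: iso_cancel_r.
Qed.

(* Kelly's redundancy of the second unit axiom. *)
Lemma lunit_tens X W : lunit M (X ⊗ W) ∘ assoc M 1 X W = lunit M X ⊗₁ idmor W.
Proof.
apply: tens1m_inj; rewrite tensm1_comp.
apply: (iso_cancel_r (f := assoc M 1 (1 ⊗ X) W)).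
apply: (iso_cancel_r (f := iso_tens (assoc M 1 1 X) (iso_id W))) => /=.
rewrite !mcompA.
have := pentagon M 1 1 X W; rewrite mcompA => ->.
rewrite compA triangle -(tensm_id M X W) -assoc_nat.
by rewrite compA -assoc_nat mcompA -tens1m_comp triangle.
Qed.

Inductive oexp := Var of C | One | Ten of oexp & oexp.

Fixpoint den (p : oexp) : C :=
  match p with
  | Var X => X
  | One => 1
  | Ten p q => den p ⊗ den q
  end.

Fixpoint flat (p : oexp) (W : C) : C :=
  match p with
  | Var X => X ⊗ W
  | One => W
  | Ten p q => flat p (flat q W)
  end.

Fixpoint flatm (p : oexp) W W' (w : Mor W W') : Mor (flat p W) (flat p W') :=
  match p return Mor (flat p W) (flat p W') with
  | Var X => idmor X ⊗₁ w
  | One => w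
  | Ten p q => flatm p (flatm q w)
  end.

Fixpoint fl (p : oexp) (W : C) : Iso (den p ⊗ W) (flat p W) :=
  match p return Iso (den p ⊗ W) (flat p W) with
  | Var X => iso_id (X ⊗ W)
  | One => lunit M W
  | Ten p q =>
      iso_comp (fl p (flat q W))
        (iso_comp (iso_tens (iso_id (den p)) (fl q W))
           (assoc M (den p) (den q) W))
  end.

Lemma flatm_id p W : flatm p (idmor W) = idmor (flat p W).
Proof.
elim: p W => [X|| p IHp q IHq] W //=; first exact: tensm_id.
by rewrite IHq IHp.
Qed.

Lemma flatm_comp p W W' W'' (g : Mor W' W'') (f : Mor W W') :
  flatm p (g ∘ f) = flatm p g ∘ flatm p f.
Proof.
elim: p W W' W'' g f => [X|| p IHp q IHq] W W' W'' g f //=.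
  exact: tensm1_comp.
by rewrite IHq IHp.
Qed.

Lemma fl_nat p W W' (w : Mor W W') :
  fl p W' ∘ (idmor (den p) ⊗₁ w) = flatm p w ∘ fl p W.
Proof.
elim: p W W' w => [X|| p IHp q IHq] W W' w /=.
- by rewrite comp1m compm1.
- exact: lunit_nat.
rewrite -tensm_id !mcompA assoc_nat (compA (_ ⊗₁ _)) -tensm1_comp IHq.
by rewrite tensm1_comp -!mcompA IHp.
Qed.

Fact genf_key : unit. Proof. exact: tt. Qed.

(* Locked, since [rewrite mcompA] would unfold it otherwise. *)
Definition genf p q (f : Mor (den p) (den q)) W : Mor (flat p W) (flat q W) :=
  locked_with genf_key (fl q W ∘ (f ⊗₁ idmor W) ∘ (fl p W)⁻¹).

Inductive mexp : oexp -> oexp -> Type :=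
  | At X Y of Mor X Y : mexp (Var X) (Var Y)
  | Gen p q of Mor (den p) (den q) : mexp p q
  | Id p : mexp p p
  | Comp p q r of mexp q r & mexp p q : mexp p r
  | TenM p p' q q' of mexp p p' & mexp q q' : mexp (Ten p q) (Ten p' q')
  | Asc p q r : mexp (Ten (Ten p q) r) (Ten p (Ten q r))
  | AscV p q r : mexp (Ten p (Ten q r)) (Ten (Ten p q) r)
  | LU p : mexp (Ten One p) p
  | RU p : mexp (Ten p One) p.

Fixpoint mden p q (f : mexp p q) : Mor (den p) (den q) :=
  match f in mexp p q return Mor (den p) (den q) with
  | At _ _ f => f
  | Gen _ _ f => f
  | Id p => idmor (den p)
  | Comp _ _ _ g f => mden g ∘ mden f
  | TenM _ _ _ _ f g => mden f ⊗₁ mden g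
  | Asc p q r => assoc M (den p) (den q) (den r)
  | AscV p q r => (assoc M (den p) (den q) (den r))⁻¹
  | LU p => lunit M (den p)
  | RU p => runit M (den p)
  end.

(* The action on right-nested products, with all associators and unitors
   dropped; [At] is [Gen] for atoms, without the trivial conjugation by [fl]. *)
Fixpoint mflat p q (f : mexp p q) W : Mor (flat p W) (flat q W) :=
  match f in mexp p q return Mor (flat p W) (flat q W) with
  | At _ _ f => f ⊗₁ idmor W
  | Gen p q f => genf f W
  | Id p => idmor (flat p W)
  | Comp _ _ _ g f => mflat g W ∘ mflat f W
  | TenM p _ _ q' f g => mflat f (flat q' W) ∘ flatm p (mflat g W)
  | Asc p q r => idmor (flat p (flat q (flat r W)))
  | AscV p q r => idmor (flat p (flat q (flat r W)))
  | LU p => idmor (flat p W)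
  | RU p => idmor (flat p W)
  end.

Lemma mflat_Comp p q r (g : mexp q r) (f : mexp p q) W :
  mflat (Comp g f) W = mflat g W ∘ mflat f W.
Proof. by []. Qed.

Lemma mflat_TenM p p' q q' (f : mexp p p') (g : mexp q q') W :
  mflat (TenM f g) W = mflat f (flat q' W) ∘ flatm p (mflat g W).
Proof. by []. Qed.

Lemma fl_assoc p q r W :
  fl (Ten p (Ten q r)) W ∘ (assoc M (den p) (den q) (den r) ⊗₁ idmor W)
  = fl (Ten (Ten p q) r) W.
Proof.
rewrite /= !mcompA; congr (_ ∘ _).
rewrite !tensm1_comp !mcompA; congr (_ ∘ _).
have := pentagon M (den p) (den q) (den r) W; rewrite !mcompA => ->.
by rewrite -tensm_id !compA assoc_nat.
Qed.

Lemma mflatP p q (f : mexp p q) W :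
  fl q W ∘ (mden f ⊗₁ idmor W) = mflat f W ∘ fl p W.
Proof.
elim: f W => {p q} [X Y f|p q f|p|p q r g IHg f IHf|p p' q q' f IHf g IHg
  |p q r|p q r|p|p] W.
- by rewrite /= comp1m compm1.
- by rewrite /= /genf unlock !mcompA fwdK compm1.
- by rewrite /= tensm_id comp1m compm1.
- by rewrite /= tens1m_comp compA IHg mcompA IHf compA.
- rewrite /= !mcompA assoc_nat (compA (_ ⊗₁ _)) -tensm_comp comp1m IHg.
  rewrite -[X in X ⊗₁ (_ ∘ _)](compm1) tensm_comp tensm_lr !mcompA.
  rewrite (compA (fl p' _)) IHf !mcompA; congr (_ ∘ _).
  by rewrite (compA (fl p _)) fl_nat !mcompA.
- by rewrite fl_assoc comp1m.
- rewrite comp1m -[in LHS]fl_assoc /=.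
  set a := assoc M (den p) (den q) (den r).
  by rewrite mcompA -tens1m_comp bwdK tensm_id compm1.
- rewrite comp1m /= -lunit_tens -!mcompA; congr (_ ∘ _).
  by rewrite lunit_nat.
- by rewrite comp1m /= triangle.
Qed.

Lemma mflat_inj p q (f g : mexp p q) :
  (forall W, mflat f W = mflat g W) -> mden f = mden g.
Proof.
move=> e; apply: tensm1_inj; apply: (iso_cancel_l (f := fl q 1)).
by rewrite !mflatP e.
Qed.

Lemma mflat_ext p q (f g : mexp p q) W :
  mden f = mden g -> mflat f W = mflat g W.
Proof.
by move=> e; apply: (iso_cancel_r (f := fl p W)); rewrite -!mflatP e.
Qed.

Lemma mflat_nat p q (f : mexp p q) W W' (w : Mor W W') :
  mflat f W' ∘ flatm p w = flatm q w ∘ mflat f W.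
Proof.
apply: (iso_cancel_r (f := fl p W)).
rewrite !mcompA -fl_nat -mflatP (compA (mflat _ _)) -mflatP.
by rewrite [in RHS]compA -fl_nat !mcompA -!tensm_comp !comp1m !compm1.
Qed.

Lemma genf_nat p q (f : Mor (den p) (den q)) W W' (w : Mor W W') :
  genf f W' ∘ flatm p w = flatm q w ∘ genf f W.
Proof. exact: (mflat_nat (Gen f)). Qed.

Lemma genf_den p q (f : mexp p q) W : genf (mden f) W = mflat f W.
Proof. exact: (@mflat_ext _ _ (Gen (mden f)) f). Qed.

Lemma genf_comp p q r (g : Mor (den q) (den r)) (f : Mor (den p) (den q)) W :
  genf (g ∘ f) W = genf g W ∘ genf f W.
Proof. exact: (genf_den (Comp (Gen g) (Gen f))). Qed.

Lemma genf_id p W : genf (idmor (den p)) W = idmor (flat p W).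
Proof. exact: (genf_den (Id p)). Qed.

Lemma genf_iso_proof p q (f : Iso (den p) (den q)) W :
  genf f⁻¹ W ∘ genf f W = idmor (flat p W) /\
  genf f W ∘ genf f⁻¹ W = idmor (flat q W).
Proof. by rewrite -!genf_comp fwdK bwdK !genf_id. Qed.

Definition genf_iso p q (f : Iso (den p) (den q)) W :
    Iso (flat p W) (flat q W) :=
  MkIso (proj1 (genf_iso_proof f W)) (proj2 (genf_iso_proof f W)).

(** * The G-braiding *)

Section Braiding.
Context {G : finGroupType} {D : grading G M} {T : right_action D}.
Context (cb : gbraiding T).
Local Notation Ten2 X Y := (Ten (Var X) (Var Y)).
Local Notation Gen2 f := (Gen (p := Ten2 _ _) (q := Ten2 _ _) f).
Local Notation genf2 f := (genf (p := Ten2 _ _) (q := Ten2 _ _) f).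

Lemma deg_eq g h X : g = h -> deg D g X -> deg D h X.
Proof. by case: h /. Qed.

Lemma br_irr X h Y (dY dY' : deg D h Y) : br cb X dY = br cb X dY' :> Mor _ _.
Proof.
have := br_nat cb dY dY' (idmor X) (idmor Y).
by rewrite fmap_id !tensm_id compm1 comp1m => ->.
Qed.

Lemma br_deg_eq X h h' Y (e : h = h') (dY : deg D h Y) (dY' : deg D h' Y) :
  br cb X dY' = (idmor Y ⊗₁ eqmor (congr1 (fun x => ract T x X) e)) ∘ br cb X dY
    :> Mor _ _.
Proof.
by case: h' / e dY' => dY' /=; rewrite tensm_id comp1m (br_irr _ _ dY).
Qed.

Definition brf (x y : oexp) h (dy : deg D h (den y)) W :
    Mor (flat x (flat y W)) (flat y (ract T h (den x) ⊗ W)) :=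
  genf (p := Ten x y) (q := Ten y (Var (ract T h (den x)))) (br cb (den x) dy)
    W.

Lemma brf_nat x y h (dy : deg D h (den y)) W W' (w : Mor W W') :
  brf x dy W' ∘ flatm x (flatm y w)
  = flatm y (idmor (ract T h (den x)) ⊗₁ w) ∘ brf x dy W.
Proof.
exact: (@genf_nat (Ten x y) (Ten y (Var (ract T h (den x))))).
Qed.

Lemma brfV_nat X y h (dy : deg D h (den y)) W W' (w : Mor W W') :
  brf (Var X) dy W' ∘ (idmor X ⊗₁ flatm y w)
  = flatm y (idmor (ract T h X) ⊗₁ w) ∘ brf (Var X) dy W.
Proof. exact: (brf_nat (Var X)). Qed.

Fact act_conj_key : unit. Proof. exact: tt. Qed.

Definition act_conj h (X X' Y Y' : C) (f : Mor (X ⊗ Y) (X' ⊗ Y')) :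
    Mor (ract T h X ⊗ ract T h Y) (ract T h X' ⊗ ract T h Y') :=
  locked_with act_conj_key
    (mu T h X' Y' ∘ fmap (ract T h) f ∘ (mu T h X Y)⁻¹).

Lemma act_conjE h (X X' Y Y' : C) (f : Mor (X ⊗ Y) (X' ⊗ Y')) :
  act_conj h f = mu T h X' Y' ∘ (fmap (ract T h) f ∘ (mu T h X Y)⁻¹).
Proof. by rewrite compA /act_conj unlock. Qed.

Lemma brf_hexl X X' Y Y' (f : Mor (X ⊗ Y) (X' ⊗ Y')) z p
    (dz : deg D p (den z)) W :
  flatm z (genf (p := Ten2 _ _) (q := Ten2 _ _) (act_conj p f) W)
    ∘ (brf (Var X) dz (ract T p Y ⊗ W) ∘ (idmor X ⊗₁ brf (Var Y) dz W))
  = brf (Var X') dz (ract T p Y' ⊗ W) ∘ (idmor X' ⊗₁ brf (Var Y') dz W)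
    ∘ genf (p := Ten2 _ _) (q := Ten2 _ _) f (flat z W).
Proof.
pose B U := Gen (p := Ten (Var U) z) (q := Ten z (Var (ract T p U)))
  (br cb U dz).
pose H U V := Comp (Asc z (Var (ract T p U)) (Var (ract T p V)))
  (Comp (TenM (B U) (Id (Var (ract T p V))))
  (Comp (AscV (Var U) z (Var (ract T p V)))
  (Comp (TenM (Id (Var U)) (B V)) (Asc (Var U) (Var V) z)))).
pose g1 := Comp (TenM (Id z)
  (Gen (p := Ten2 _ _) (q := Ten2 _ _) (act_conj p f))) (H X Y).
pose g2 := Comp (H X' Y')
  (TenM (Gen (p := Ten2 _ _) (q := Ten2 _ _) f) (Id z)).
have hex U V : mden (H U V) = (idmor (den z) ⊗₁ mu T p U V) ∘ br cb (U ⊗ V) dz.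
  by rewrite /= !compA br_hexl.
have e : mden g1 = mden g2.
  have -> : mden g1 = (idmor (den z) ⊗₁ act_conj p f) ∘ mden (H X Y) by [].
  have -> : mden g2 = mden (H X' Y') ∘ (f ⊗₁ idmor (den z)) by [].
  rewrite !hex mcompA br_nat !compA -!tensm1_comp act_conjE !mcompA fwdK.
  by rewrite compm1.
have := mflat_ext W e; rewrite /= !(comp1m, compm1, tensm_id, flatm_id).
by rewrite /brf !mcompA.
Qed.

Lemma brf_hexr X y z h p (dy : deg D h (den y)) (dz : deg D p (den z)) W
    (dyz : deg D (h * p)%g (den (Ten y z))) :
  flatm y (flatm z (gam T h p X ⊗₁ idmor W))
    ∘ brf (Var X) (y := Ten y z) dyz W
  = flatm y (brf (Var (ract T h X)) dz W)
    ∘ brf (Var X) dy (flat z W).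
Proof.
pose B U v m (d : deg D m (den v)) :=
  Gen (p := Ten (Var U) v) (q := Ten v (Var (ract T m U))) (br cb U d).
pose g1 := Comp (Asc y z (Var (ract T p (ract T h X))))
  (Comp (TenM (Id (Ten y z)) (At (gam T h p X)))
  (Comp (B X (Ten y z) (h * p)%g dyz) (Asc (Var X) y z))).
pose g2 := Comp (TenM (Id y) (B (ract T h X) z p dz))
  (Comp (Asc y (Var (ract T h X)) z)
        (TenM (B X y h dy) (Id z))).
have e : mden g1 = mden g2.
  rewrite /= !compA -(br_hexr cb X dy dz).
  by rewrite (br_irr X dyz (deg_tens dy dz)).
have := mflat_ext W e.
by rewrite /= !(comp1m, compm1, tensm_id, flatm_id).
Qed.

(* By the hexagon for [1 ⊗ 1], the left-hand side is idempotent. *)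
Lemma brf_unit z p (dz : deg D p (den z)) W :
  flatm z (genf (p := Var (ract T p 1)) (q := One) (mu0 T p) W)
    ∘ brf One dz W
  = idmor (flat z W).
Proof.
pose v := ract T p 1; pose m0 := Gen (p := Var v) (q := One) (mu0 T p).
pose B := Gen (p := Ten One z) (q := Ten z (Var v)) (br cb 1 dz).
pose H := Comp (Asc z (Var v) (Var v))
  (Comp (TenM B (Id (Var v))) (Comp (AscV One z (Var v))
  (Comp (TenM (Id One) B) (Asc One One z)))).
have hex : mden H = (idmor (den z) ⊗₁ mu T p 1 1) ∘ br cb (1 ⊗ 1) dz.
  by rewrite /= !compA br_hexl.
pose g1 := Comp (TenM (Id z) (Comp (LU (Var v))
  (TenM m0 (Id (Var v))))) H.
pose g2 := Comp B (TenM (LU One) (Id z)).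
have e : mden g1 = mden g2.
  have -> : mden g2 = br cb 1 dz ∘ (lunit M 1 ⊗₁ idmor (den z)) by [].
  have -> : mden g1 = (idmor (den z) ⊗₁ (lunit M v ∘ (mu0 T p ⊗₁ idmor v)))
    ∘ mden H by [].
  by rewrite hex br_nat -mu_lunit compA -tensm1_comp.
pose phi U := flatm z (mflat m0 U) ∘ brf One dz U.
have phiv U : phi (v ⊗ U) = idmor _.
  apply: (iso_cancel_r (f := @genf_iso (Ten One z) (Ten z (Var v)) (br cb 1 dz)
    U)).
  have e1 := mflat_ext U e; rewrite /= !(comp1m, compm1, tensm_id, flatm_id) in
    e1.
  by rewrite comp1m [LHS]mcompA; exact: e1.
pose w := @genf_iso (Var v) One (mu0 T p) W.
have := brf_nat One dz w => wnat.
have idE : idmor (flat z W) = flatm z w ∘ flatm z w⁻¹.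
  by rewrite -flatm_comp bwdK flatm_id.
have phi_nat : phi W ∘ flatm z w = flatm z w ∘ phi (v ⊗ W).
  have m0_nat : mflat m0 W ∘ (idmor v ⊗₁ w) = w ∘ mflat m0 (v ⊗ W).
    exact: (mflat_nat m0 w).
  by rewrite /phi mcompA wnat !compA -!flatm_comp m0_nat.
rewrite -/(phi W) -[phi W]compm1 [X in _ ∘ X = _]idE [LHS]compA phi_nat phiv.
by rewrite compm1 -idE.
Qed.

(** * The zested product of homogeneous objects *)

Section Zesting.
Context (z : assoc_zesting_datum cb).
Local Notation lam := (lam z).

(* [nu] with free indices, so that the associativity of [G] never has to be
   transported along. *)
Definition nug a b c ab bc (e : (a * b)%g = ab) (e' : (b * c)%g = bc) :
    Iso (ract T c (lam a b) ⊗ lam ab c) (lam b c ⊗ lam a bc) :=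
  match e in _ = ab, e' in _ = bc
    return Iso (ract T c (lam a b) ⊗ lam ab c) (lam b c ⊗ lam a bc) with
  | erefl, erefl => nu z a b c
  end.

Lemma nugf_eqmor a b c ab bc (e : (a * b)%g = ab) (e' : (b * c)%g = bc)
    (l : (a * b)%g = ab) (r : (b * c)%g = bc) W :
  genf2 (nug e e') W
  = (idmor (lam b c) ⊗₁ (eqmor (congr1 (lam a) r) ⊗₁ idmor W))
    ∘ (genf2 (nu z a b c) W
    ∘ (idmor (ract T c (lam a b))
         ⊗₁ (eqmor (congr1 (lam^~ c) (esym l)) ⊗₁ idmor W))).
Proof.
case: _ / e l; case: _ / e' r => r l.
by rewrite (eq_irrelevance l erefl) (eq_irrelevance r erefl) !tensm_id comp1m
  compm1.
Qed.

Lemma nug_cocyclef a b c d abc bcd (e1 : (a * b * c)%g = abc)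
    (e2 : (a * (b * c))%g = abc) (e3 : (b * c * d)%g = bcd)
    (e4 : (b * (c * d))%g = bcd) W :
    genf2 (nug (erefl (b * c)%g) (erefl (c * d)%g)) (lam a bcd ⊗ W)
    ∘ ((idmor (ract T d (lam b c)) ⊗₁ genf2 (nug e2 e3) W)
    ∘ genf2 (act_conj d (nug (erefl (a * b)%g) (erefl (b * c)%g)))
        (lam abc d ⊗ W))
  = (idmor (lam c d) ⊗₁ genf2 (nug (erefl (a * b)%g) e4) W)
    ∘ ((idmor (lam c d)
          ⊗₁ ((gam0 T (ract T (c * d)%g (lam a b)))⁻¹ ⊗₁ idmor _))
    ∘ (brf (Var (ract T (c * d)%g (lam a b))) (y := Var (lam c d))
         (lam_deg z c d) (lam (a * b)%g (c * d)%g ⊗ W)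
    ∘ (((gam T c d (lam a b))⁻¹ ⊗₁ idmor _)
    ∘ (idmor (ract T d (ract T c (lam a b)))
         ⊗₁ genf2 (nug e1 (erefl (c * d)%g)) W)))).
Proof.
case: abc / e1 e2 => e2; case: bcd / e4 e3 => e3.
pose V := Var.
pose g1 :=
  Comp (TenM (Gen2 (nu z b c d : Mor _ _))
          (At (eqmor (congr1 (lam a) (esym (mulgA b c d))))))
  (Comp (AscV (V (ract T d (lam b c))) (V (lam (b * c)%g d))
          (V (lam a (b * c * d)%g)))
  (Comp (TenM (Id (V (ract T d (lam b c))))
    (Gen2 (nu z a (b * c)%g d : Mor _ _)))
  (Comp (Asc (V (ract T d (lam b c))) (V (ract T d (lam a (b * c)%g)))
           (V (lam (a * (b * c))%g d)))
    (TenM (Gen2 (act_conj d (nu z a b c)))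
       (At (eqmor (congr1 (lam^~ d) (esym (mulgA a b c))))))))).
pose g2 :=
  Comp (AscV (V (lam c d)) (V (lam b (c * d)%g)) (V (lam a (b * (c * d))%g)))
  (Comp (TenM (Id (V (lam c d))) (Gen2 (nu z a b (c * d)%g : Mor _ _)))
  (Comp (Asc (V (lam c d)) (V (ract T (c * d)%g (lam a b)))
          (V (lam (a * b)%g (c * d)%g)))
  (Comp (TenM (Comp (TenM (Id (V (lam c d)))
                     (At (gam0 T (ract T (c * d)%g (lam a b)))⁻¹))
           (Gen2 (br cb (ract T (c * d)%g (lam a b)) (lam_deg z c d) : Mor _
             _)))
           (Id (V (lam (a * b)%g (c * d)%g))))
  (Comp (AscV (V (ract T (c * d)%g (lam a b))) (V (lam c d))
          (V (lam (a * b)%g (c * d)%g)))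
  (Comp (TenM (At (gam T c d (lam a b))⁻¹)
    (Gen2 (nu z (a * b)%g c d : Mor _ _)))
    (Asc (V (ract T d (ract T c (lam a b))))
        (V (ract T d (lam (a * b)%g c))) (V (lam (a * b * c)%g d)))))))).
have e : mden g1 = mden g2.
  by have := nu_cocycle z a b c d; rewrite /= act_conjE !mcompA.
have := mflat_ext W e; rewrite /= !(comp1m, compm1, tensm_id) => {e g1 g2} e.
rewrite !mcompA in e; apply: (etrans _ e) => {e}.
rewrite (nugf_eqmor _ _ e2 e3) !tensm1_comp !mcompA.
rewrite (genf_nat (p := Ten2 _ _) (q := Ten2 _ _)) /=.
by rewrite (eq_irrelevance e3 (esym (mulgA b c d)))
  (eq_irrelevance e2 (mulgA a b c)).
Qed.

Definition zt a b X Y := (X ⊗ Y) ⊗ lam a b.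
Definition ztE a b (x y : oexp) := Ten (Ten x y) (Var (lam a b)).

Lemma zt_deg a b X Y : deg D a X -> deg D b Y -> deg D (a * b)%g (zt a b X Y).
Proof.
move=> dX dY; apply: (deg_eq (mulg1 (a * b)%g)).
by apply: deg_tens; [exact: deg_tens | exact: lam_deg].
Qed.

Section Associator.
Context (a b c ab bc : G) (e : (a * b)%g = ab) (e' : (b * c)%g = bc).
Context (x y z' : oexp) (dz : deg D c (den z')).

Fact zassE_key : unit. Proof. exact: tt. Qed.

Definition zassE :
    mexp (ztE ab c (ztE a b x y) z') (ztE a bc x (ztE b c y z')) :=
  let l := Var (lam a b) in let l' := Var (lam ab c) in
  let lc := Var (ract T c (lam a b)) in
  let m := Var (lam b c) in let m' := Var (lam a bc) in
  locked_with zassE_key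
  (Comp (AscV x (Ten (Ten y z') m) m')
  (Comp (TenM (Id x) (AscV (Ten y z') m m'))
  (Comp (TenM (Id x) (AscV y z' (Ten m m')))
  (Comp (Asc x y (Ten z' (Ten m m')))
  (Comp (TenM (Id (Ten x y)) (TenM (Id z') (Gen2 (nug e e' : Mor _ _))))
  (Comp (TenM (Id (Ten x y)) (Asc z' lc l'))
  (Comp (Asc (Ten x y) (Ten z' lc) l')
  (Comp (TenM (TenM (Id (Ten x y))
           (Gen (p := Ten l z') (q := Ten z' lc) (br cb (lam a b) dz)))
           (Id l'))
        (TenM (Asc (Ten x y) l z') (Id l')))))))))).

Definition zass : Iso (den (ztE ab c (ztE a b x y) z'))
    (den (ztE a bc x (ztE b c y z'))) :=
  let l := lam a b in let l' := lam ab c in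
  let lc := ract T c l in let m := lam b c in let m' := lam a bc in
  let X := den x in let Y := den y in let Z := den z' in
  iso_comp (iso_inv (assoc M X ((Y ⊗ Z) ⊗ m) m'))
  (iso_comp (iso_tens (iso_id X) (iso_inv (assoc M (Y ⊗ Z) m m')))
  (iso_comp (iso_tens (iso_id X) (iso_inv (assoc M Y Z (m ⊗ m'))))
  (iso_comp (assoc M X Y (Z ⊗ (m ⊗ m')))
  (iso_comp (iso_tens (iso_id (X ⊗ Y)) (iso_tens (iso_id Z) (nug e e')))
  (iso_comp (iso_tens (iso_id (X ⊗ Y)) (assoc M Z lc l'))
  (iso_comp (assoc M (X ⊗ Y) (Z ⊗ lc) l')
  (iso_comp (iso_tens (iso_tens (iso_id (X ⊗ Y)) (br cb l dz)) (iso_id l'))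
            (iso_tens (assoc M (X ⊗ Y) l Z) (iso_id l'))))))))).

Lemma zassP : zass = mden zassE :> Mor _ _.
Proof. by rewrite /zassE unlock. Qed.

Definition zassf W :=
  flatm z' (genf2 (nug e e') W) ∘ brf (Var (lam a b)) dz (lam ab c ⊗ W).

Lemma zassfP W : mflat zassE W = flatm x (flatm y (zassf W)).
Proof.
rewrite /zassE unlock /= !(tensm_id, flatm_id, comp1m, compm1).
by rewrite -!flatm_comp.
Qed.

End Associator.

Lemma brf_zt X c d (y w : oexp) (dy : deg D c (den y)) (dw : deg D d (den w))
    (dyw : deg D (c * d)%g (den (ztE c d y w))) U :
  brf (Var X) dyw U
  = flatm y (flatm w
      ((idmor (lam c d) ⊗₁ ((gam0 T (ract T (c * d)%g X))⁻¹ ⊗₁ idmor U))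
       ∘ (brf (Var (ract T (c * d)%g X)) (y := Var (lam c d))
            (lam_deg z c d) U
       ∘ ((gam T c d X)⁻¹ ⊗₁ idmor (lam c d ⊗ U)))))
    ∘ (flatm y (brf (Var (ract T c X)) dw (lam c d ⊗ U))
    ∘ brf (Var X) dy (flat w (lam c d ⊗ U))).
Proof.
have d2 : deg D (c * d)%g (den (Ten y w)) := deg_tens dy dw.
have d1 : deg D (c * d * 1)%g (den (ztE c d y w)) := deg_tens d2
  (lam_deg z c d).
have q := mulg1 (c * d)%g.
have -> : brf (Var X) dyw U
    = flatm (ztE c d y w) (eqmor (congr1 (fun x => ract T x X) q) ⊗₁ idmor U)
      ∘ brf (Var X) d1 U.
  rewrite /brf (br_deg_eq X q d1 dyw).
  rewrite (genf_comp (q := Ten (ztE c d y w) (Var (ract T (c * d * 1)%g X)))).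
  congr (_ ∘ _).
  have := genf_den (TenM (Id (ztE c d y w))
    (At (eqmor (congr1 (fun x => ract T x X) q)))) U.
  by rewrite /= comp1m.
have -> : eqmor (congr1 (fun x => ract T x X) q)
    = (gam0 T (ract T (c * d)%g X))⁻¹ ∘ gam T (c * d)%g 1%g X.
  apply: (iso_cancel_l (f := gam0 T (ract T (c * d)%g X))).
  rewrite comp_bwdK -(gam_runit T) mcompA (eq_irrelevance (mulg1 _) q).
  by rewrite (eqmor_congr1K (fun x => ract T x X)) compm1.
rewrite tens1m_comp flatm_comp mcompA.
have -> := brf_hexr X d2 (z := Var (lam c d)) (lam_deg z c d) U d1.
have := brf_hexr X dy dw (lam c d ⊗ U) d2; rewrite /= => <-.
rewrite [in RHS]compA -!flatm_comp !mcompA -tens1m_comp fwdK tensm_id compm1.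
by rewrite !flatm_comp !mcompA.
Qed.

Section Pentagon.
Context (a b c d ab bc cd abc bcd : G).
Context (eab : (a * b)%g = ab) (ebc : (b * c)%g = bc) (ecd : (c * d)%g = cd).
Context (eabc : (ab * c)%g = abc) (eabc' : (a * bc)%g = abc).
Context (ebcd : (bc * d)%g = bcd) (ebcd' : (b * cd)%g = bcd).
Context (x y v w : oexp) (dv : deg D c (den v)) (dw : deg D d (den w)).
Context (dvw : deg D cd (den (ztE c d v w))).

Lemma zass_pentagon :
  mden (Comp (TenM (TenM (Id x) (zassE ebc ecd y v dw)) (Id (Var (lam a bcd))))
    (Comp (zassE eabc' ebcd x (ztE b c y v) dw)
      (TenM (TenM (zassE eab ebc x y dv) (Id w)) (Id (Var (lam abc d))))))
  = mden (Comp (zassE eab ebcd' x y dvw) (zassE eabc ecd (ztE a b x y) v dw)).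
Proof.
apply: mflat_inj => W.
rewrite !(mflat_Comp, mflat_TenM) !zassfP /=.
rewrite !(tensm_id, flatm_id, comp1m, compm1) -!flatm_comp.
congr (flatm x (flatm y _)).
move: eabc eabc' ebcd ebcd' dvw; case: _ / eab; case: _ / ebc; case: _ / ecd.
move=> e1 e2 e3 e4 d1.
rewrite /zassf brf_zt -[flatm (ztE c d v w) _]/(flatm v (flatm w
  (idmor (lam c d) ⊗₁ genf2 (nug (erefl (a * b)%g) e4) W))).
rewrite !mcompA brfV_nat !compA -!flatm_comp.
congr (flatm v _ ∘ _); rewrite !mcompA !tensm1_comp.
rewrite !mcompA (compA (brf (Var (lam b c)) _ _)) brfV_nat.
rewrite (compA (brf (Var (ract T c (lam a b))) _ _)) brfV_nat.
rewrite !mcompA (compA (brf (Var (lam b c)) _ _)) -brf_hexl.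
rewrite !compA -!flatm_comp !mcompA; congr (flatm w _ ∘ _).
exact: nug_cocyclef.
Qed.

End Pentagon.
Lemma brfV_natr X h Y Y' (dY : deg D h (den (Var Y)))
    (dY' : deg D h (den (Var Y'))) (g : Mor Y Y') W :
  brf (Var X) dY' W ∘ (idmor X ⊗₁ (g ⊗₁ idmor W))
  = (g ⊗₁ idmor (ract T h X ⊗ W)) ∘ brf (Var X) dY W.
Proof.
pose B Z (d : deg D h (den (Var Z))) := Gen2 (br cb X d : Mor (X ⊗ Z) _).
pose g1 := Comp (B Y' dY') (TenM (Id (Var X)) (At g)).
pose g2 := Comp (TenM (At g) (Id (Var (ract T h X)))) (B Y dY).
have e : mden g1 = mden g2.
  by rewrite /= br_nat fmap_id.
by have := mflat_ext W e; rewrite /= !(tensm_id, comp1m, compm1).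
Qed.

Lemma brf_natl (x x' y : oexp) h (dy : deg D h (den y))
    (f : Mor (den x) (den x')) W :
  flatm y (genf (p := Var (ract T h (den x))) (q := Var (ract T h (den x')))
             (fmap (ract T h) f) W) ∘ brf x dy W
  = brf x' dy W ∘ genf f (flat y W).
Proof.
pose B x := Gen (p := Ten x y) (q := Ten y (Var (ract T h (den x))))
  (br cb (den x) dy).
pose g1 := Comp (TenM (Id y) (Gen (p := Var _) (q := Var _)
  (fmap (ract T h) f))) (B x).
pose g2 := Comp (B x') (TenM (Gen f) (Id y)).
have e : mden g1 = mden g2.
  by rewrite /= br_nat.
by have := mflat_ext W e; rewrite /= !(flatm_id, comp1m, compm1).
Qed.

Definition ztm a b X X' Y Y' (f : Mor X X') (g : Mor Y Y') :
    Mor (zt a b X Y) (zt a b X' Y') :=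
  (f ⊗₁ g) ⊗₁ idmor (lam a b).

Lemma zass_nat a b c ab bc (e : (a * b)%g = ab) (e' : (b * c)%g = bc)
    X X' Y Y' Z Z' (dZ : deg D c Z) (dZ' : deg D c Z')
    (f : Mor X X') (g : Mor Y Y') (h : Mor Z Z') :
  zass e e' (Var X') (Var Y') (z' := Var Z') dZ' ∘ ztm ab c (ztm a b f g) h
  = ztm a bc f (ztm b c g h) ∘ zass e e' (Var X) (Var Y) (z' := Var Z) dZ.
Proof.
pose t a b (p p' q q' : oexp) (u : mexp p p') (v : mexp q q') :=
  TenM (TenM u v) (Id (Var (lam a b))).
pose g1 := Comp (zassE e e' (Var X') (Var Y') (z' := Var Z') dZ')
  (t ab c _ _ _ _ (t a b _ _ _ _ (At f) (At g)) (At h)).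
pose g2 := Comp (t a bc _ _ _ _ (At f) (t b c _ _ _ _ (At g) (At h)))
  (zassE e e' (Var X) (Var Y) (z' := Var Z) dZ).
rewrite !zassP; suff: mden g1 = mden g2 by [].
apply: mflat_inj => W.
rewrite /g1 /g2 /t !mflat_Comp !zassfP !mflat_TenM /=.
rewrite !(tensm_id, comp1m, compm1, =^~ tensm_comp).
congr (_ ⊗₁ (_ ⊗₁ _)).
rewrite /zassf /= mcompA brfV_natr !compA -!tensm_comp.
by rewrite !(comp1m, compm1).
Qed.

Definition zlunit b Y : Iso (zt 1%g b 1 Y) Y :=
  iso_comp (runit M Y) (iso_tens (lunit M Y) (iso_eq (lam1g z b))).

Definition zrunit a X : Iso (zt a 1%g X 1) X :=
  iso_comp (runit M X) (iso_tens (runit M X) (iso_eq (lamg1 z a))).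

Lemma zlunit_nat b Y Y' (f : Mor Y Y') :
  zlunit b Y' ∘ ztm 1%g b (idmor 1) f = f ∘ zlunit b Y.
Proof.
rewrite /= /ztm mcompA -tensm_comp lunit_nat compm1 -(comp1m (eqmor _)).
by rewrite tensm_comp compA runit_nat mcompA comp1m.
Qed.

Lemma zrunit_nat a X X' (f : Mor X X') :
  zrunit a X' ∘ ztm a 1%g f (idmor 1) = f ∘ zrunit a X.
Proof.
rewrite /= /ztm mcompA -tensm_comp runit_nat compm1 -(comp1m (eqmor _)).
by rewrite tensm_comp compA runit_nat mcompA comp1m.
Qed.

Lemma nugE a b c ab bc (e : (a * b)%g = ab) (e' : (b * c)%g = bc) :
  nug e e' = (idmor (lam b c) ⊗₁ eqmor (congr1 (lam a) e')) ∘ nu z a b c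
    ∘ (idmor (ract T c (lam a b)) ⊗₁ eqmor (congr1 (lam^~ c) (esym e)))
    :> Mor _ _.
Proof. by case: _ / e; case: _ / e'; rewrite !tensm_id comp1m compm1. Qed.

Lemma nug_unit a b (e : (a * 1)%g = a) (e' : (1 * b)%g = b) :
  (eqmor (lam1g z b) ⊗₁ idmor (lam a b)) ∘ nug e e'
  = (mu0 T b ∘ fmap (ract T b) (eqmor (lamg1 z a))) ⊗₁ idmor (lam a b).
Proof.
rewrite nugE nu_norm -!tensm_comp !(comp1m, compm1).
rewrite (eq_irrelevance e (mulg1 a)) (eq_irrelevance e' (mul1g b)).
rewrite !compA eqmorK_esym comp1m; congr (_ ⊗₁ _).
have := eqmor_congr1K (lam a) (esym (mul1g b)); rewrite esymK => ->.
have := eqmor_congr1K (lam^~ b) (esym (mulg1 a)); rewrite esymK comp1m.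
by [].
Qed.

Lemma zass_triangle a b (e : (a * 1)%g = a) (e' : (1 * b)%g = b) X Y
    (dY : deg D b Y) :
  ztm a b (idmor X) (zlunit b Y)
    ∘ zass e e' (Var X) One (z' := Var Y) dY
  = ztm a b (zrunit a X) (idmor Y).
Proof.
pose l1 := Gen (p := Var _) (q := One) (eqmor (lam1g z b)).
pose r1 := Gen (p := Var _) (q := One) (eqmor (lamg1 z a)).
pose m0 := Gen (p := Var _) (q := One)
  (mu0 T b ∘ fmap (ract T b) (eqmor (lamg1 z a))).
pose I := Id (Var (lam a b)).
pose g1 := Comp (TenM (TenM (Id (Var X)) (Comp (RU (Var Y))
    (TenM (LU (Var Y)) l1))) I)
  (zassE e e' (Var X) One (z' := Var Y) dY).
pose g2 := TenM (TenM (Comp (RU (Var X)) (TenM (RU (Var X)) r1))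
  (Id (Var Y))) I.
rewrite zassP; suff: mden g1 = mden g2 by [].
apply: mflat_inj => W; rewrite /g1 mflat_Comp zassfP.
rewrite /= !(comp1m, compm1, tensm_id) -tensm1_comp; congr (_ ⊗₁ _).
rewrite /zassf /= compA -tensm1_comp.
pose h1 := Comp (LU (Var (lam a b))) (Comp (TenM l1 I)
  (Gen2 (nug e e' : Mor _ _))).
pose h2 := Comp (LU (Var (lam a b))) (TenM m0 I).
have eh : mden h1 = mden h2 by rewrite /= nug_unit.
have e1 := mflat_ext W eh; rewrite /= !(tensm_id, comp1m, compm1) in e1.
rewrite e1 (genf_comp (q := Var (ract T b 1))) tensm1_comp mcompA.
have e2 := brf_natl (x := Var (lam a 1%g)) (x' := One) (y := Var Y) dY
  (eqmor (lamg1 z a)) (lam a b ⊗ W).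
rewrite [flatm (Var Y) _]/= in e2; rewrite e2 compA.
have e3 := brf_unit (z := Var Y) dY (lam a b ⊗ W).
rewrite [flatm (Var Y) _]/= in e3; rewrite e3.
by rewrite comp1m.
Qed.

Lemma unit_deg : deg D 1%g 1.
Proof. by rewrite -(lam1g z 1%g); exact: lam_deg. Qed.

End Zesting.

End Braiding.

End Flattening.

(** * Direct sums *)

Section LinearCategory.
Context {k : fieldType} {C : lincat k}.
Implicit Types X Y Z : C.

Lemma compDm X Y Z (g g' : Mor Y Z) (f : Mor X Y) :
  (g + g') ∘ f = g ∘ f + g' ∘ f.
Proof. by have := comp_linearl 1 g g' f; rewrite !scale1r. Qed.

Lemma compmD X Y Z (g : Mor Y Z) (f f' : Mor X Y) :
  g ∘ (f + f') = g ∘ f + g ∘ f'.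
Proof. by have := comp_linearr 1 g f f'; rewrite !scale1r. Qed.

Lemma comp0m X Y Z (f : Mor X Y) : (0 : Mor Y Z) ∘ f = 0.
Proof. by apply: (addrI (0 ∘ f)); rewrite -compDm !addr0. Qed.

Lemma compm0 X Y Z (g : Mor Y Z) : g ∘ (0 : Mor X Y) = 0.
Proof. by apply: (addrI (g ∘ 0)); rewrite -compmD !addr0. Qed.

Lemma comp_suml (I : finType) X Y Z (F : I -> Mor Y Z) (f : Mor X Y) :
  (\sum_i F i) ∘ f = \sum_i (F i ∘ f).
Proof.
apply: (big_morph (fun g => g ∘ f)) => [g g'|]; [exact: compDm|exact: comp0m].
Qed.

Lemma comp_sumr (I : finType) X Y Z (g : Mor Y Z) (F : I -> Mor X Y) :
  g ∘ (\sum_i F i) = \sum_i (g ∘ F i).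
Proof.
apply: (big_morph (fun f => g ∘ f)) => [f f'|]; [exact: compmD|exact: compm0].
Qed.

Record biprod (I : finType) (F : I -> C) (S : C) := Biprod {
  inj : forall i, Mor (F i) S;
  prj : forall i, Mor S (F i);
  prj_inj : forall i, prj i ∘ inj i = idmor (F i);
  prj_inj0 : forall i j, i != j -> prj j ∘ inj i = 0;
  sum_inj_prj : \sum_i inj i ∘ prj i = idmor S }.

Definition biprod_of_direct_sum (I : finType) (F : I -> C) S :
  is_direct_sum F S -> biprod F S.
Proof.
move=> /constructive_indefinite_description[i].
by move=> /constructive_indefinite_description[p []]; exists i p.
Defined.

Lemma biprod_ext (I : finType) (F : I -> C) S (B : biprod F S) W
    (f g : Mor S W) :
  (forall i, f ∘ inj B i = g ∘ inj B i) -> f = g.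
Proof.
move=> e; rewrite -[f]compm1 -[g]compm1 -(sum_inj_prj B) !comp_sumr.
by apply: eq_bigr => i _; rewrite !compA e.
Qed.

Lemma sum_prj_inj (I : finType) (F : I -> C) S S' (B : biprod F S)
    (u : forall i, Mor (F i) S') i :
  (\sum_j u j ∘ prj B j) ∘ inj B i = u i.
Proof.
rewrite comp_suml (bigD1 i) //= mcompA prj_inj compm1 big1 ?addr0 // => j nji.
by rewrite mcompA prj_inj0 ?compm0 // eq_sym.
Qed.

Definition biprod_of_ext (I : finType) (F : I -> C) S
    (i : forall t, Mor (F t) S) (p : forall t, Mor S (F t)) :
  (forall t, p t ∘ i t = idmor _) ->
  (forall s t, s != t -> p t ∘ i s = 0) ->
  (forall f g : Mor S S, (forall t, f ∘ i t = g ∘ i t) -> f = g) ->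
  biprod F S.
Proof.
move=> pi pi0 ext; exists i p => //.
apply: ext => t; rewrite comp_suml comp1m (bigD1 t) //= mcompA pi compm1.
rewrite big1 ?addr0 // => s nst.
by rewrite mcompA pi0 ?compm0 // eq_sym.
Defined.

Section BiprodIso.
Context (I : finType) (F F' : I -> C) (S S' : C).
Context (B : biprod F S) (B' : biprod F' S') (A : forall i, Iso (F i) (F' i)).

Let f := \sum_i (inj B' i ∘ A i) ∘ prj B i.
Let g := \sum_i (inj B i ∘ (A i)⁻¹) ∘ prj B' i.

Lemma biprod_iso_proof : g ∘ f = idmor S /\ f ∘ g = idmor S'.
Proof.
split.
  apply: (biprod_ext (B := B)) => i.
  by rewrite mcompA !sum_prj_inj compA sum_prj_inj mcompA fwdK compm1 comp1m.
apply: (biprod_ext (B := B')) => i.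
by rewrite mcompA !sum_prj_inj compA sum_prj_inj mcompA bwdK compm1 comp1m.
Qed.

Definition biprod_iso : Iso S S' :=
  MkIso (proj1 biprod_iso_proof) (proj2 biprod_iso_proof).

Lemma biprod_iso_inj i : biprod_iso ∘ inj B i = inj B' i ∘ A i.
Proof. exact: sum_prj_inj. Qed.

End BiprodIso.

End LinearCategory.

(** * Additive extension of a product of homogeneous objects *)

Section AdditiveExtension.
Context {k : fieldType} {G : finGroupType} {C : lincat k} {M : monoidal C}.
Context (D : grading G M).

(* A monoidal structure on homogeneous objects.  The degrees of products are
   free indices, related by equations, so that they need no transport. *)
Record homog_monoidal := HomogMonoidal {
  htens : G -> G -> C -> C -> C;
  htensm : forall a b (X X' Y Y' : C),
    Mor X X' -> Mor Y Y' -> Mor (htens a b X Y) (htens a b X' Y');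
  htm_id : forall a b (X Y : C),
    htensm a b (idmor X) (idmor Y) = idmor (htens a b X Y);
  htm_comp : forall a b (X X' X'' Y Y' Y'' : C) (f' : Mor X' X'')
      (f : Mor X X') (g' : Mor Y' Y'') (g : Mor Y Y'),
    htensm a b (f' ∘ f) (g' ∘ g) = htensm a b f' g' ∘ htensm a b f g;
  htm_linearl : forall a b (X X' Y Y' : C) s (f f' : Mor X X') (g : Mor Y Y'),
    htensm a b (s *: f + f') g = s *: htensm a b f g + htensm a b f' g;
  htm_linearr : forall a b (X X' Y Y' : C) s (f : Mor X X') (g g' : Mor Y Y'),
    htensm a b f (s *: g + g') = s *: htensm a b f g + htensm a b f g';
  ht_deg : forall a b (X Y : C), deg D a X -> deg D b Y ->
    deg D (a * b)%g (htens a b X Y);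
  hunit : C;
  hunit_deg : deg D 1%g hunit;
  hass : forall a b c ab bc, (a * b)%g = ab -> (b * c)%g = bc ->
    forall X Y Z : C, deg D c Z ->
    Iso (htens ab c (htens a b X Y) Z) (htens a bc X (htens b c Y Z));
  hass_nat : forall a b c ab bc (e : (a * b)%g = ab) (e' : (b * c)%g = bc)
      (X X' Y Y' Z Z' : C) (dZ : deg D c Z) (dZ' : deg D c Z')
      (f : Mor X X') (g : Mor Y Y') (h : Mor Z Z'),
    hass e e' X' Y' dZ' ∘ htensm ab c (htensm a b f g) h
    = htensm a bc f (htensm b c g h) ∘ hass e e' X Y dZ;
  hass_pentagon : forall a b c d ab bc cd abc bcd
      (eab : (a * b)%g = ab) (ebc : (b * c)%g = bc) (ecd : (c * d)%g = cd)
      (eabc : (ab * c)%g = abc) (eabc' : (a * bc)%g = abc)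
      (ebcd : (bc * d)%g = bcd) (ebcd' : (b * cd)%g = bcd)
      (X Y Z W : C) (dZ : deg D c Z) (dW : deg D d W)
      (dZW : deg D cd (htens c d Z W)),
    htensm a bcd (idmor X) (hass ebc ecd Y Z dW)
      ∘ (hass eabc' ebcd X (htens b c Y Z) dW
      ∘ htensm abc d (hass eab ebc X Y dZ) (idmor W))
    = hass eab ebcd' X Y dZW ∘ hass eabc ecd (htens a b X Y) Z dW;
  hlunit : forall b (Y : C), Iso (htens 1%g b hunit Y) Y;
  hrunit : forall a (X : C), Iso (htens a 1%g X hunit) X;
  hlunit_nat : forall b (Y Y' : C) (f : Mor Y Y'),
    hlunit b Y' ∘ htensm 1%g b (idmor hunit) f = f ∘ hlunit b Y;
  hrunit_nat : forall a (X X' : C) (f : Mor X X'),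
    hrunit a X' ∘ htensm a 1%g f (idmor hunit) = f ∘ hrunit a X;
  htriangle : forall a b (e : (a * 1)%g = a) (e' : (1 * b)%g = b) (X Y : C)
      (dY : deg D b Y),
    htensm a b (idmor X) (hlunit b Y) ∘ hass e e' X hunit dY
    = htensm a b (hrunit a X) (idmor Y) }.

Arguments htensm h a b {X X' Y Y'} f g : rename.

Context (H : homog_monoidal).
Context (dec : forall X : C,
  {F : G -> C & ((forall g, deg D g (F g)) * biprod F X)%type}).
Context (sum : forall F : G * G -> C, {S : C & biprod F S}).
Implicit Types X Y Z W : C.
Local Notation htm := (htensm H).
Local Notation ht := (htens H).
Local Notation U := (hunit H).

Definition cmp X g : C := projT1 (dec X) g.
Definition cmp_deg X g : deg D g (cmp X g) := (projT2 (dec X)).1 g.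
Definition cmp_biprod X : biprod (cmp X) X := (projT2 (dec X)).2.
Definition cin X g : Mor (cmp X g) X := inj (cmp_biprod X) g.
Definition cpr X g : Mor X (cmp X g) := prj (cmp_biprod X) g.

Lemma cpr_in X g : cpr X g ∘ cin X g = idmor (cmp X g).
Proof. exact: prj_inj. Qed.

Lemma cin_prl g W X (f : Mor W X) : deg D g W -> cin X g ∘ (cpr X g ∘ f) = f.
Proof.
move=> dW; rewrite -[RHS]comp1m -(sum_inj_prj (cmp_biprod X)) comp_suml.
rewrite (bigD1 g) //= big1 ?addr0 ?mcompA // => h nhg.
rewrite mcompA (deg_orth _ dW (cmp_deg X h) (prj _ h ∘ f)) ?compm0 //.
by rewrite eq_sym.
Qed.

Lemma cin_prr g W X (f : Mor X W) : deg D g W -> f ∘ cin X g ∘ cpr X g = f.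
Proof.
move=> dW; rewrite -[RHS]compm1 -(sum_inj_prj (cmp_biprod X)) comp_sumr.
rewrite (bigD1 g) //= big1 ?addr0 ?mcompA // => h nhg.
by rewrite compA (deg_orth nhg (cmp_deg X h) dW (f ∘ inj _ h)) ?comp0m.
Qed.

Definition cm g X Y (f : Mor X Y) : Mor (cmp X g) (cmp Y g) :=
  cpr Y g ∘ (f ∘ cin X g).

Lemma cm_in g X Y (f : Mor X Y) : cin Y g ∘ cm g f = f ∘ cin X g.
Proof. by rewrite cin_prl //; exact: cmp_deg. Qed.

Lemma cm_pr g X Y (f : Mor X Y) : cm g f ∘ cpr X g = cpr Y g ∘ f.
Proof. by rewrite /cm compA cin_prr //; exact: cmp_deg. Qed.

Lemma cm_id g X : cm g (idmor X) = idmor (cmp X g).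
Proof. by rewrite /cm comp1m cpr_in. Qed.

Lemma cm_comp g X Y Z (f' : Mor Y Z) (f : Mor X Y) :
  cm g (f' ∘ f) = cm g f' ∘ cm g f.
Proof.
by rewrite {1}/cm mcompA -cm_in compA -cm_pr mcompA (compA (cpr _ _)) cpr_in
  comp1m.
Qed.

Lemma cm_linear g X Y s (f f' : Mor X Y) :
  cm g (s *: f + f') = s *: cm g f + cm g f'.
Proof. by rewrite /cm comp_linearl comp_linearr. Qed.

Lemma htmDl a b X X' Y Y' (f f' : Mor X X') (g : Mor Y Y') :
  htm a b (f + f') g = htm a b f g + htm a b f' g.
Proof. by have := htm_linearl H a b 1 f f' g; rewrite !scale1r. Qed.

Lemma htmDr a b X X' Y Y' (f : Mor X X') (g g' : Mor Y Y') :
  htm a b f (g + g') = htm a b f g + htm a b f g'.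
Proof. by have := htm_linearr H a b 1 f g g'; rewrite !scale1r. Qed.

Lemma htm0l a b X X' Y Y' (g : Mor Y Y') : htm a b (0 : Mor X X') g = 0.
Proof. by apply: (addrI (htm a b 0 g)); rewrite -htmDl !addr0. Qed.

Lemma htm0r a b X X' Y Y' (f : Mor X X') : htm a b f (0 : Mor Y Y') = 0.
Proof. by apply: (addrI (htm a b f 0)); rewrite -htmDr !addr0. Qed.

Definition hsummand X Y (p : G * G) := ht p.1 p.2 (cmp X p.1) (cmp Y p.2).
Definition etens X Y : C := projT1 (sum (hsummand X Y)).
Definition etens_biprod X Y : biprod (hsummand X Y) (etens X Y) :=
  projT2 (sum (hsummand X Y)).
Definition ein X Y a b : Mor (ht a b (cmp X a) (cmp Y b)) (etens X Y) :=
  inj (etens_biprod X Y) (a, b).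
Definition epr X Y a b : Mor (etens X Y) (ht a b (cmp X a) (cmp Y b)) :=
  prj (etens_biprod X Y) (a, b).

Lemma epr_in X Y a b : epr X Y a b ∘ ein X Y a b = idmor _.
Proof. exact: prj_inj (etens_biprod X Y) (a, b). Qed.

Lemma epr_in0 X Y a b a' b' : (a, b) != (a', b') ->
  epr X Y a' b' ∘ ein X Y a b = 0.
Proof. exact: prj_inj0. Qed.

Lemma sum_ein_epr X Y :
  \sum_p ein X Y p.1 p.2 ∘ epr X Y p.1 p.2 = idmor (etens X Y).
Proof. by rewrite -(sum_inj_prj (etens_biprod X Y)); apply: eq_bigr => -[]. Qed.

Lemma etens_ext X Y W (f g : Mor (etens X Y) W) :
  (forall a b, f ∘ ein X Y a b = g ∘ ein X Y a b) -> f = g.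
Proof.
by move=> e; apply: (biprod_ext (B := etens_biprod X Y)) => -[a b]; apply: e.
Qed.

Definition etensm X X' Y Y' (f : Mor X X') (g : Mor Y Y') :
    Mor (etens X Y) (etens X' Y') :=
  \sum_p (ein X' Y' p.1 p.2 ∘ htm p.1 p.2 (cm p.1 f) (cm p.2 g))
           ∘ epr X Y p.1 p.2.

Lemma etensm_in X X' Y Y' (f : Mor X X') (g : Mor Y Y') a b :
  etensm f g ∘ ein X Y a b = ein X' Y' a b ∘ htm a b (cm a f) (cm b g).
Proof.
rewrite /etensm -(sum_prj_inj (etens_biprod X Y) (fun p =>
  ein X' Y' p.1 p.2 ∘ htm p.1 p.2 (cm p.1 f) (cm p.2 g)) (a, b)).
by congr (_ ∘ _); apply: eq_bigr => -[].
Qed.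

Lemma etensm_id X Y : etensm (idmor X) (idmor Y) = idmor (etens X Y).
Proof.
by apply: etens_ext => a b; rewrite etensm_in !cm_id htm_id compm1 comp1m.
Qed.

Lemma etensm_comp X X' X'' Y Y' Y'' (f' : Mor X' X'') (f : Mor X X')
    (g' : Mor Y' Y'') (g : Mor Y Y') :
  etensm (f' ∘ f) (g' ∘ g) = etensm f' g' ∘ etensm f g.
Proof.
apply: etens_ext => a b.
by rewrite etensm_in mcompA etensm_in !cm_comp htm_comp !compA etensm_in.
Qed.

Definition etens_bifunctor : bifunctor C := Bifunctor etensm_id etensm_comp.

Lemma etens_bilinear : bilinear_tensor etens_bifunctor.
Proof.
split=> X X' Y Y' s f f' g; apply: etens_ext => a b;
by rewrite comp_linearl !etensm_in cm_linear (htm_linearl, htm_linearr)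
  comp_linearr.
Qed.

Definition inc X Y a b m :
    Mor (ht a b (cmp X a) (cmp Y b)) (cmp (etens X Y) m) :=
  cpr (etens X Y) m ∘ ein X Y a b.
Definition prc X Y a b m :
    Mor (cmp (etens X Y) m) (ht a b (cmp X a) (cmp Y b)) :=
  epr X Y a b ∘ cin (etens X Y) m.

Lemma summand_deg X Y a b m : (a * b)%g = m ->
  deg D m (ht a b (cmp X a) (cmp Y b)).
Proof. by move=> <-; apply: ht_deg; exact: cmp_deg. Qed.

Lemma cin_inc X Y a b m : (a * b)%g = m ->
  cin (etens X Y) m ∘ inc X Y a b m = ein X Y a b.
Proof. by move=> e; rewrite cin_prl //; exact: summand_deg. Qed.

Lemma inc0 X Y a b m : (a * b)%g != m -> inc X Y a b m = 0.
Proof.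
move=> ne; exact: deg_orth ne (summand_deg X Y erefl) (cmp_deg _ _) _.
Qed.

Lemma prc_inc X Y a b m : (a * b)%g = m ->
  prc X Y a b m ∘ inc X Y a b m = idmor _.
Proof. by move=> e; rewrite mcompA cin_inc // epr_in. Qed.

Lemma prc_inc0 X Y a b a' b' m : (a, b) != (a', b') ->
  prc X Y a' b' m ∘ inc X Y a b m = 0.
Proof.
move=> ne; have [e|ne'] := eqVneq (a * b)%g m; last by rewrite inc0 // compm0.
by rewrite mcompA cin_inc // epr_in0.
Qed.

Lemma sum_inc_prc X Y m :
  \sum_p inc X Y p.1 p.2 m ∘ prc X Y p.1 p.2 m = idmor (cmp (etens X Y) m).
Proof.
rewrite -cpr_in -[cin _ m]comp1m -sum_ein_epr comp_suml comp_sumr.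
by apply: eq_bigr => p _; rewrite !mcompA.
Qed.

Lemma cm_inc X X' Y Y' (f : Mor X X') (g : Mor Y Y') a b m :
  cm m (etensm f g) ∘ inc X Y a b m = inc X' Y' a b m ∘ htm a b (cm a f)
    (cm b g).
Proof. by rewrite compA cm_pr mcompA etensm_in compA. Qed.

(* To be applied to an expression containing the component of [etens X Y] of
   degree [m], with [Q] the additive dependence on its identity. *)
Lemma inc_ext X Y m (V : zmodType)
    (Q Q' : Mor (cmp (etens X Y) m) (cmp (etens X Y) m) -> V) :
  {morph Q : f g / f + g} -> {morph Q' : f g / f + g} ->
  (forall a b w, (a * b)%g = m ->
     Q (inc X Y a b m ∘ w) = Q' (inc X Y a b m ∘ w)) ->
  Q (idmor _) = Q' (idmor _).
Proof.
move=> QD Q'D e.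
have Q0 : Q 0 = 0 by apply: (addrI (Q 0)); rewrite -QD !addr0.
have Q'0 : Q' 0 = 0 by apply: (addrI (Q' 0)); rewrite -Q'D !addr0.
rewrite -sum_inc_prc (big_morph Q QD Q0) (big_morph Q' Q'D Q'0).
apply: eq_bigr => -[a b] _ /=.
have [eab|ne] := eqVneq (a * b)%g m; first exact: e.
by rewrite inc0 // comp0m Q0 Q'0.
Qed.

Lemma htm_compl a b X X' X'' Y (f' : Mor X' X'') (f : Mor X X') :
  htm a b (f' ∘ f) (idmor Y) = htm a b f' (idmor Y) ∘ htm a b f (idmor Y).
Proof. by rewrite -htm_comp comp1m. Qed.

Lemma htm_compr a b X Y Y' Y'' (g' : Mor Y' Y'') (g : Mor Y Y') :
  htm a b (idmor X) (g' ∘ g) = htm a b (idmor X) g' ∘ htm a b (idmor X) g.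
Proof. by rewrite -htm_comp comp1m. Qed.

Lemma htm_swap a b X X' Y Y' (f : Mor X X') (g : Mor Y Y') :
  htm a b f (idmor Y') ∘ htm a b (idmor X) g
  = htm a b (idmor X') g ∘ htm a b f (idmor Y).
Proof. by rewrite -!htm_comp !(comp1m, compm1). Qed.

Section Triple.
Context (X Y Z : C).

Definition iL a b m c :
    Mor (ht m c (ht a b (cmp X a) (cmp Y b)) (cmp Z c)) (etens (etens X Y) Z) :=
  ein (etens X Y) Z m c ∘ htm m c (inc X Y a b m) (idmor (cmp Z c)).
Definition pL a b m c :
    Mor (etens (etens X Y) Z) (ht m c (ht a b (cmp X a) (cmp Y b)) (cmp Z c)) :=
  htm m c (prc X Y a b m) (idmor (cmp Z c)) ∘ epr (etens X Y) Z m c.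

Definition iR a b c n :
    Mor (ht a n (cmp X a) (ht b c (cmp Y b) (cmp Z c))) (etens X (etens Y Z)) :=
  ein X (etens Y Z) a n ∘ htm a n (idmor (cmp X a)) (inc Y Z b c n).
Definition pR a b c n :
    Mor (etens X (etens Y Z)) (ht a n (cmp X a) (ht b c (cmp Y b) (cmp Z c))) :=
  htm a n (idmor (cmp X a)) (prc Y Z b c n) ∘ epr X (etens Y Z) a n.

Lemma pL_iL a b m c : (a * b)%g = m -> pL a b m c ∘ iL a b m c = idmor _.
Proof.
move=> e; rewrite mcompA (compA (epr _ _ _ _)) epr_in comp1m -htm_compl
  prc_inc //.
exact: htm_id.
Qed.

Lemma pL_iL0 a b m c a' b' m' c' : (a, b, c) != (a', b', c') ->
  pL a' b' m' c' ∘ iL a b m c = 0.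
Proof.
move=> ne; rewrite mcompA (compA (epr _ _ _ _)).
have [[em ec]|ne'] := eqVneq (m, c) (m', c'); last first.
  by rewrite epr_in0 // comp0m compm0.
case: m' / em; case: c' / ec ne => ne.
rewrite epr_in comp1m -htm_compl prc_inc0 ?htm0l //.
by apply: contra ne => /eqP[-> ->].
Qed.

Lemma pR_iR a b c n : (b * c)%g = n -> pR a b c n ∘ iR a b c n = idmor _.
Proof.
move=> e; rewrite mcompA (compA (epr _ _ _ _)) epr_in comp1m -htm_compr
  prc_inc //.
exact: htm_id.
Qed.

Lemma pR_iR0 a b c n a' b' c' n' : (a, b, c) != (a', b', c') ->
  pR a' b' c' n' ∘ iR a b c n = 0.
Proof.
move=> ne; rewrite mcompA (compA (epr _ _ _ _)).
have [[ea en]|ne'] := eqVneq (a, n) (a', n'); last first.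
  by rewrite epr_in0 // comp0m compm0.
case: a' / ea ne; case: n' / en => ne.
rewrite epr_in comp1m -htm_compr prc_inc0 ?htm0r //.
by apply: contra ne => /eqP[-> ->].
Qed.

Lemma iL_ext W (f g : Mor (etens (etens X Y) Z) W) :
  (forall a b m c, (a * b)%g = m -> f ∘ iL a b m c = g ∘ iL a b m c) -> f = g.
Proof.
move=> e; apply: etens_ext => m c; rewrite -[ein _ _ m c]compm1 -htm_id.
apply: (inc_ext
  (Q := fun t => f ∘ (ein (etens X Y) Z m c ∘ htm m c t (idmor _)))
  (Q' := fun t => g ∘ (ein (etens X Y) Z m c ∘ htm m c t (idmor _)))).
- by move=> s t; rewrite htmDl !compmD.
- by move=> s t; rewrite htmDl !compmD.
by move=> a b w eab; rewrite htm_compl (compA (ein _ _ _ _))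
  !(compA _ _ (htm _ _ w _)) e.
Qed.

Lemma iR_ext W (f g : Mor (etens X (etens Y Z)) W) :
  (forall a b c n, (b * c)%g = n -> f ∘ iR a b c n = g ∘ iR a b c n) -> f = g.
Proof.
move=> e; apply: etens_ext => a n; rewrite -[ein _ _ a n]compm1 -htm_id.
apply: (inc_ext
  (Q := fun t => f ∘ (ein X (etens Y Z) a n ∘ htm a n (idmor _) t))
  (Q' := fun t => g ∘ (ein X (etens Y Z) a n ∘ htm a n (idmor _) t))).
- by move=> s t; rewrite htmDr !compmD.
- by move=> s t; rewrite htmDr !compmD.
by move=> b c w ebc; rewrite htm_compr (compA (ein _ _ _ _))
  !(compA _ _ (htm _ _ _ w)) e.
Qed.

Definition summandL (t : G * G * G) :=
  ht (t.1.1 * t.1.2)%g t.2 (ht t.1.1 t.1.2 (cmp X t.1.1) (cmp Y t.1.2))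
    (cmp Z t.2).

Definition summandR (t : G * G * G) :=
  ht t.1.1 (t.1.2 * t.2)%g (cmp X t.1.1)
    (ht t.1.2 t.2 (cmp Y t.1.2) (cmp Z t.2)).

Definition biprodL : biprod summandL (etens (etens X Y) Z).
Proof.
apply: (biprod_of_ext
  (i := fun t => iL t.1.1 t.1.2 (t.1.1 * t.1.2)%g t.2)
  (p := fun t => pL t.1.1 t.1.2 (t.1.1 * t.1.2)%g t.2)).
- by move=> t; apply: pL_iL.
- by move=> [[a b] c] [[a' b'] c'] ne; apply: pL_iL0.
by move=> f g e; apply: iL_ext => a b m c <-; apply: (e (a, b, c)).
Defined.

Definition biprodR : biprod summandR (etens X (etens Y Z)).
Proof.
apply: (biprod_of_ext
  (i := fun t => iR t.1.1 t.1.2 t.2 (t.1.2 * t.2)%g)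
  (p := fun t => pR t.1.1 t.1.2 t.2 (t.1.2 * t.2)%g)).
- by move=> t; apply: pR_iR.
- by move=> [[a b] c] [[a' b'] c'] ne; apply: pR_iR0.
by move=> f g e; apply: iR_ext => a b c n <-; apply: (e (a, b, c)).
Defined.

Definition eass : Iso (etens (etens X Y) Z) (etens X (etens Y Z)) :=
  biprod_iso biprodL biprodR (fun t =>
    hass H (erefl (t.1.1 * t.1.2)%g) (erefl (t.1.2 * t.2)%g)
      (cmp X t.1.1) (cmp Y t.1.2) (cmp_deg Z t.2)).

Lemma eass_iL a b m c n (e : (a * b)%g = m) (e' : (b * c)%g = n) :
  eass ∘ iL a b m c
  = iR a b c n ∘ hass H e e' (cmp X a) (cmp Y b) (cmp_deg Z c).
Proof.
case: m / e; case: n / e'.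
exact: (biprod_iso_inj biprodL biprodR _ (a, b, c)).
Qed.

End Triple.

Lemma etensm_iL X X' Y Y' Z Z' (f : Mor X X') (g : Mor Y Y') (h : Mor Z Z')
    a b m c :
  etensm (etensm f g) h ∘ iL X Y Z a b m c
  = iL X' Y' Z' a b m c ∘ htm m c (htm a b (cm a f) (cm b g)) (cm c h).
Proof.
rewrite compA etensm_in !mcompA -!htm_comp cm_inc.
by rewrite comp1m compm1.
Qed.

Lemma etensm_iR X X' Y Y' Z Z' (f : Mor X X') (g : Mor Y Y') (h : Mor Z Z')
    a b c n :
  etensm f (etensm g h) ∘ iR X Y Z a b c n
  = iR X' Y' Z' a b c n ∘ htm a n (cm a f) (htm b c (cm b g) (cm c h)).
Proof.
rewrite compA etensm_in !mcompA -!htm_comp cm_inc.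
by rewrite comp1m compm1.
Qed.

Lemma eass_nat X X' Y Y' Z Z' (f : Mor X X') (g : Mor Y Y') (h : Mor Z Z') :
  eass X' Y' Z' ∘ etensm (etensm f g) h = etensm f (etensm g h) ∘ eass X Y Z.
Proof.
apply: iL_ext => a b m c e; rewrite !mcompA etensm_iL.
have e' := erefl (b * c)%g.
rewrite (eass_iL X Y Z e e') (compA (eass X' Y' Z')) (eass_iL _ _ _ e e').
rewrite (compA (etensm _ _)) etensm_iR !mcompA.
by congr (_ ∘ (_ ∘ _)); exact: hass_nat.
Qed.

Lemma cm_eass_cin X Y Z a b ab c abc bc (e : (a * b)%g = ab)
    (e' : (b * c)%g = bc) :
  cm abc (eass X Y Z)
    ∘ (inc (etens X Y) Z ab c abc ∘ htm ab c (inc X Y a b ab) (idmor (cmp Z c)))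
  = inc X (etens Y Z) a bc abc ∘ (htm a bc (idmor (cmp X a)) (inc Y Z b c bc)
      ∘ hass H e e' (cmp X a) (cmp Y b) (cmp_deg Z c)).
Proof.
have E := eass_iL X Y Z e e'; rewrite mcompA in E.
by rewrite [inc (etens X Y) _ _ _ _]/inc mcompA compA cm_pr mcompA E compA.
Qed.

Lemma iLL_ext X Y Z W V (f g : Mor (etens (etens (etens X Y) Z) W) V) :
  (forall a b ab c abc d, (a * b)%g = ab -> (ab * c)%g = abc ->
     f ∘ (iL (etens X Y) Z W ab c abc d
       ∘ htm abc d (htm ab c (inc X Y a b ab) (idmor (cmp Z c)))
         (idmor (cmp W d)))
     = g ∘ (iL (etens X Y) Z W ab c abc d
       ∘ htm abc d (htm ab c (inc X Y a b ab) (idmor (cmp Z c)))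
         (idmor (cmp W d)))) ->
  f = g.
Proof.
move=> e; apply: iL_ext => ab c abc d eabc.
pose Q (h : Mor (etens (etens (etens X Y) Z) W) V)
    (t : Mor (cmp (etens X Y) ab) (cmp (etens X Y) ab)) :=
  h ∘ (iL (etens X Y) Z W ab c abc d ∘ htm abc d (htm ab c t (idmor _))
    (idmor _)).
have QE h : h ∘ iL (etens X Y) Z W ab c abc d = Q h (idmor _).
  by rewrite /Q !htm_id compm1.
rewrite !QE; apply: inc_ext; rewrite {QE}/Q.
- by move=> s t; rewrite !htmDl !compmD.
- by move=> s t; rewrite !htmDl !compmD.
move=> a b w eab; rewrite (htm_compl _ _ _ (inc X Y a b ab) w).
rewrite (htm_compl _ _ _ (htm _ _ (inc X Y a b ab) _))
  (compA (iL _ _ _ _ _ _ _)).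
by rewrite !(compA _ _ (htm _ _ (htm _ _ w _) _)) e.
Qed.

Lemma eass_pentagon X Y Z W :
  etensm (idmor X) (eass Y Z W) ∘ eass X (etens Y Z) W
    ∘ etensm (eass X Y Z) (idmor W)
  = eass X Y (etens Z W) ∘ eass (etens X Y) Z W.
Proof.
apply: iLL_ext => a b ab c abc d eab eabc.
pose bc := (b * c)%g; pose bcd := (bc * d)%g; pose cd := (c * d)%g.
have ebc : (b * c)%g = bc by [].
have ebcd : (bc * d)%g = bcd by [].
have ecd : (c * d)%g = cd by [].
have eabc' : (a * bc)%g = abc by rewrite -eabc -eab mulgA.
have ebcd' : (b * cd)%g = bcd by rewrite /bcd /bc mulgA.
have dcd := summand_deg Z W ecd.
pose J := ein X (etens Y (etens Z W)) a bcd ∘ htm a bcd (idmor (cmp X a))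
  (inc Y (etens Z W) b cd bcd ∘ htm b cd (idmor (cmp Y b)) (inc Z W c d cd)).
have S1 : etensm (eass X Y Z) (idmor W) ∘ (iL (etens X Y) Z W ab c abc d
      ∘ htm abc d (htm ab c (inc X Y a b ab) (idmor _)) (idmor _))
    = iL X (etens Y Z) W a bc abc d
      ∘ (htm abc d (htm a bc (idmor _) (inc Y Z b c bc)) (idmor _)
      ∘ htm abc d (hass H eab ebc _ _ (cmp_deg Z c)) (idmor _)).
  rewrite {1}/iL mcompA -htm_compl compA etensm_in cm_id mcompA -htm_compl.
  by rewrite (cm_eass_cin X Y Z abc eab ebc) /iL mcompA -!htm_compl.
have S3 : etensm (idmor X) (eass Y Z W) ∘ (iR X (etens Y Z) W a bc d bcd
      ∘ htm a bcd (idmor _) (htm bc d (inc Y Z b c bc) (idmor _)))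
    = J ∘ htm a bcd (idmor _) (hass H ebc ecd _ _ (cmp_deg W d)).
  rewrite {1}/iR mcompA -htm_compr compA etensm_in cm_id mcompA -htm_compr.
  by rewrite (cm_eass_cin Y Z W bcd ebc ecd) /J mcompA -htm_compr mcompA.
have S5 : iR (etens X Y) Z W ab c d cd ∘ htm ab cd (inc X Y a b ab) (idmor _)
    = iL X Y (etens Z W) a b ab cd ∘ htm ab cd (idmor _) (inc Z W c d cd).
  by rewrite /iR /iL !mcompA htm_swap.
have S7 : iR X Y (etens Z W) a b cd bcd
      ∘ htm a bcd (idmor _) (htm b cd (idmor _) (inc Z W c d cd)) = J.
  by rewrite /iR /J mcompA -htm_compr.
rewrite (mcompA _ (etensm (eass X Y Z) _)) S1.
rewrite (mcompA (etensm _ _)) (compA (eass X (etens Y Z) W)).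
rewrite (eass_iL _ _ _ eabc' ebcd) (mcompA (iR _ _ _ _ _ _ _)).
rewrite (compA (hass _ _ _ _ _ _)) (hass_nat _ _ _ (cmp_deg W d)).
rewrite (mcompA (htm a bcd _ _)) (compA (iR _ _ _ _ _ _ _)).
rewrite (compA (etensm _ _)) S3 (mcompA J).
rewrite (hass_pentagon eab ebc ecd eabc eabc' ebcd ebcd' _ _ _ _ dcd).
rewrite (mcompA (eass X Y _)) (compA (eass (etens X Y) Z W)).
rewrite (eass_iL _ _ _ eabc ecd) (mcompA (iR _ _ _ _ _ _ _)).
rewrite (hass_nat _ _ _ (cmp_deg W d)) htm_id (compA (iR _ _ _ _ _ _ _)) S5.
rewrite (mcompA (iL _ _ _ _ _ _ _)) (compA (eass X Y _)).
rewrite (eass_iL _ _ _ eab ebcd') (mcompA (iR _ _ _ _ _ _ _)).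
rewrite (compA (hass _ _ _ _ _ _)) -htm_id (hass_nat _ _ _ dcd).
by rewrite (mcompA (htm a bcd _ _)) (compA (iR _ _ _ _ _ _ _)) S7.
Qed.

Lemma cin_pr_deg g W : deg D g W -> cin W g ∘ cpr W g = idmor W.
Proof. by move=> dW; rewrite -[cpr W g]compm1 cin_prl. Qed.

Lemma cmp_id0 g h W : deg D g W -> g != h -> idmor (cmp W h) = 0.
Proof.
move=> dW ne; rewrite -cpr_in.
by rewrite (deg_orth ne dW (cmp_deg W h) (cpr W h)) comp0m.
Qed.

Lemma etens_extl g W Y V (f f' : Mor (etens W Y) V) : deg D g W ->
  (forall b, f ∘ (ein W Y g b ∘ htm g b (cpr W g) (idmor _))
             = f' ∘ (ein W Y g b ∘ htm g b (cpr W g) (idmor _))) -> f = f'.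
Proof.
move=> dW e; apply: etens_ext => a b; have [<-|ne] := eqVneq g a.
  rewrite -[ein _ _ g b]compm1 -htm_id -(cpr_in W g) htm_compl.
  by rewrite (compA (ein _ _ _ _)) !(compA _ _ (htm _ _ (cin _ _) _)) e.
by rewrite -[ein _ _ a b]compm1 -htm_id (cmp_id0 dW ne) htm0l !compm0.
Qed.

Lemma etens_extr g W X V (f f' : Mor (etens X W) V) : deg D g W ->
  (forall a, f ∘ (ein X W a g ∘ htm a g (idmor _) (cpr W g))
             = f' ∘ (ein X W a g ∘ htm a g (idmor _) (cpr W g))) -> f = f'.
Proof.
move=> dW e; apply: etens_ext => a b; have [<-|ne] := eqVneq g b.
  rewrite -[ein _ _ a g]compm1 -htm_id -(cpr_in W g) htm_compr.
  by rewrite (compA (ein _ _ _ _)) !(compA _ _ (htm _ _ _ (cin _ _))) e.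
by rewrite -[ein _ _ a b]compm1 -htm_id (cmp_id0 dW ne) htm0r !compm0.
Qed.

Definition biprod_unitl X : biprod (fun b => ht 1%g b U (cmp X b)) (etens U X).
Proof.
apply: (biprod_of_ext
  (i := fun b => ein U X 1%g b ∘ htm 1%g b (cpr U 1%g) (idmor (cmp X b)))
  (p := fun b => htm 1%g b (cin U 1%g) (idmor (cmp X b)) ∘ epr U X 1%g b)).
- move=> b; rewrite mcompA (compA (epr _ _ _ _)) epr_in comp1m -htm_compl.
  by rewrite cin_pr_deg ?htm_id //; exact: hunit_deg.
- move=> b c ne; rewrite mcompA (compA (epr _ _ _ _)) epr_in0 ?comp0m
  ?compm0 //.
  by apply: contra ne => /eqP[->].
by move=> f g; apply/etens_extl/hunit_deg.
Defined.

Definition biprod_unitr X : biprod (fun a => ht a 1%g (cmp X a) U) (etens X U).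
Proof.
apply: (biprod_of_ext
  (i := fun a => ein X U a 1%g ∘ htm a 1%g (idmor (cmp X a)) (cpr U 1%g))
  (p := fun a => htm a 1%g (idmor (cmp X a)) (cin U 1%g) ∘ epr X U a 1%g)).
- move=> b; rewrite mcompA (compA (epr _ _ _ _)) epr_in comp1m -htm_compr.
  by rewrite cin_pr_deg ?htm_id //; exact: hunit_deg.
- move=> b c ne; rewrite mcompA (compA (epr _ _ _ _)) epr_in0 ?comp0m
  ?compm0 //.
  by apply: contra ne => /eqP[->].
by move=> f g; apply/etens_extr/hunit_deg.
Defined.

Definition elunit X : Iso (etens U X) X :=
  biprod_iso (biprod_unitl X) (cmp_biprod X) (fun b => hlunit H b (cmp X b)).

Definition erunit X : Iso (etens X U) X :=
  biprod_iso (biprod_unitr X) (cmp_biprod X) (fun a => hrunit H a (cmp X a)).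

Lemma elunit_in X b :
  elunit X ∘ (ein U X 1%g b ∘ htm 1%g b (cpr U 1%g) (idmor _))
  = cin X b ∘ hlunit H b (cmp X b).
Proof. exact: (biprod_iso_inj (biprod_unitl X) (cmp_biprod X) _ b). Qed.

Lemma erunit_in X a :
  erunit X ∘ (ein X U a 1%g ∘ htm a 1%g (idmor _) (cpr U 1%g))
  = cin X a ∘ hrunit H a (cmp X a).
Proof. exact: (biprod_iso_inj (biprod_unitr X) (cmp_biprod X) _ a). Qed.

Lemma elunit_nat X X' (f : Mor X X') :
  elunit X' ∘ etensm (idmor U) f = f ∘ elunit X.
Proof.
apply: (etens_extl (hunit_deg H)) => b.
rewrite mcompA (compA (etensm _ _)) etensm_in cm_id mcompA
  -(htm_swap 1%g b (cpr U _)).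
rewrite (compA (ein _ _ _ _)) (compA (elunit _)) elunit_in.
rewrite mcompA hlunit_nat compA cm_in mcompA -elunit_in.
by rewrite (mcompA f).
Qed.

Lemma erunit_nat X X' (f : Mor X X') :
  erunit X' ∘ etensm f (idmor U) = f ∘ erunit X.
Proof.
apply: (etens_extr (hunit_deg H)) => a.
rewrite mcompA (compA (etensm _ _)) etensm_in cm_id mcompA
  (htm_swap a 1%g _ (cpr U _)).
rewrite (compA (ein _ _ _ _)) (compA (erunit _)) erunit_in.
rewrite mcompA hrunit_nat compA cm_in mcompA -erunit_in.
by rewrite (mcompA f).
Qed.

Lemma cm_elunit_cin Y b :
  cm b (elunit Y) ∘ (inc U Y 1%g b b ∘ htm 1%g b (cpr U 1%g) (idmor _))
  = hlunit H b (cmp Y b).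
Proof.
rewrite (mcompA (cpr _ _) (ein _ _ _ _)) (compA (cm _ _)) cm_pr mcompA
  elunit_in.
by rewrite compA cpr_in comp1m.
Qed.

Lemma cm_erunit_cin X a :
  cm a (erunit X) ∘ (inc X U a 1%g a ∘ htm a 1%g (idmor _) (cpr U 1%g))
  = hrunit H a (cmp X a).
Proof.
rewrite (mcompA (cpr _ _) (ein _ _ _ _)) (compA (cm _ _)) cm_pr mcompA
  erunit_in.
by rewrite compA cpr_in comp1m.
Qed.

Lemma etriangle X Y :
  etensm (idmor X) (elunit Y) ∘ eass X U Y = etensm (erunit X) (idmor Y).
Proof.
apply: iL_ext => a b m c em.
have [eb|ne] := eqVneq 1%g b; last first.
  have -> : iL X U Y a b m c = 0.
    rewrite -[LHS]compm1 -!htm_id (cmp_id0 (hunit_deg H) ne) htm0r htm0l.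
    exact: compm0.
  by rewrite !compm0.
case: b / eb em => em; have ea := mulg1 a; rewrite em in ea.
case: a / ea em => em.
pose w := htm m c (htm m 1%g (idmor (cmp X m)) (cpr U 1%g)) (idmor (cmp Y c)).
suff: etensm (idmor X) (elunit Y) ∘ eass X U Y ∘ (iL X U Y m 1%g m c ∘ w)
    = etensm (erunit X) (idmor Y) ∘ (iL X U Y m 1%g m c ∘ w).
  move=> /(congr1 (fun f => f ∘ htm m c
    (htm m 1%g (idmor (cmp X m)) (cin U 1%g)) (idmor (cmp Y c)))).
  by rewrite !(mcompA _ (_ ∘ w)) !(mcompA _ w) /w -htm_compl -htm_compr cpr_in
    !htm_id !compm1.
have e1 := mul1g c.
rewrite (mcompA (etensm _ _)) (compA (eass _ _ _)) (eass_iL _ _ _ em e1).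
rewrite (mcompA (iR _ _ _ _ _ _ _)) /w (hass_nat _ _ _ (cmp_deg Y c)).
rewrite {1}/iR (mcompA (ein _ _ _ _)) (compA (htm m c _ _) (htm m c _ _)).
rewrite -htm_compr (compA (etensm _ _)) etensm_in cm_id.
rewrite (mcompA (ein _ _ _ _)) (compA (htm m c _ _) (htm m c _ _)) -htm_compr.
rewrite cm_elunit_cin htriangle {1}/iL (mcompA (ein _ _ _ _)) -htm_compl.
by rewrite (compA (etensm _ _)) etensm_in cm_id mcompA -htm_compl cm_erunit_cin.
Qed.

Definition etens_monoidal : monoidal C :=
  @Monoidal k C etens_bifunctor U eass elunit erunit eass_nat elunit_nat
    erunit_nat eass_pentagon etriangle.

Section Homogeneous.
Context (a b : G) (X Y : C) (dX : deg D a X) (dY : deg D b Y).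

Lemma etens_homog_proof :
  (ein X Y a b ∘ htm a b (cpr X a) (cpr Y b))
    ∘ (htm a b (cin X a) (cin Y b) ∘ epr X Y a b) = idmor (etens X Y) /\
  (htm a b (cin X a) (cin Y b) ∘ epr X Y a b)
    ∘ (ein X Y a b ∘ htm a b (cpr X a) (cpr Y b)) = idmor (ht a b X Y).
Proof.
rewrite !mcompA (compA (epr _ _ _ _)) epr_in comp1m (compA (htm _ _ _ _)).
rewrite -!htm_comp !cpr_in !cin_pr_deg // !htm_id comp1m; split=> //.
apply: (etens_extl dX) => c; have [<-|ne] := eqVneq b c.
  by rewrite mcompA (compA (epr _ _ _ _)) epr_in !comp1m.
by rewrite -(cm_id c Y) /cm comp1m (cpr_in Y) (cmp_id0 dY ne) htm0r !compm0.
Qed.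

Definition etens_homog : Iso (etens X Y) (ht a b X Y) :=
  MkIso (proj1 etens_homog_proof) (proj2 etens_homog_proof).

End Homogeneous.

Lemma etens_homog_nat a b X X' Y Y' (dX : deg D a X) (dX' : deg D a X')
    (dY : deg D b Y) (dY' : deg D b Y') (f : Mor X X') (g : Mor Y Y') :
  etens_homog dX' dY' ∘ etensm f g = htm a b f g ∘ etens_homog dX dY.
Proof.
apply: etens_ext => c d /=; rewrite !mcompA etensm_in.
have [[<- <-]|ne] := eqVneq (a, b) (c, d).
  by rewrite (compA (epr _ _ _ _)) !epr_in comp1m compm1 -!htm_comp !cm_in.
by rewrite (compA (epr _ _ _ _)) !epr_in0 1?eq_sym // comp0m !compm0.
Qed.

End AdditiveExtension.

Section ZestingHomog.
Context {k : fieldType} {G : finGroupType} {C : lincat k} {M : monoidal C}.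
Context {D : grading G M} {T : right_action D} {cb : gbraiding T}.
Context (z : assoc_zesting_datum cb) (bil : bilinear_tensor M).

Lemma ztm_id a b (X Y : C) :
  ztm z a b (idmor X) (idmor Y) = idmor (zt z a b X Y).
Proof. by rewrite /ztm !tensm_id. Qed.

Lemma ztm_comp a b (X X' X'' Y Y' Y'' : C) (f' : Mor X' X'') (f : Mor X X')
    (g' : Mor Y' Y'') (g : Mor Y Y') :
  ztm z a b (f' ∘ f) (g' ∘ g) = ztm z a b f' g' ∘ ztm z a b f g.
Proof. by rewrite /ztm tensm_comp tens1m_comp. Qed.

Lemma ztm_linearl a b (X X' Y Y' : C) s (f f' : Mor X X') (g : Mor Y Y') :
  ztm z a b (s *: f + f') g = s *: ztm z a b f g + ztm z a b f' g.
Proof. by case: bil => l r; rewrite /ztm !l. Qed.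

Lemma ztm_linearr a b (X X' Y Y' : C) s (f : Mor X X') (g g' : Mor Y Y') :
  ztm z a b f (s *: g + g') = s *: ztm z a b f g + ztm z a b f g'.
Proof. by case: bil => l r; rewrite /ztm r l. Qed.

Definition zesting_homog : homog_monoidal D.
Proof.
refine (@HomogMonoidal k G C M D (zt z) (ztm z) ztm_id ztm_comp ztm_linearl
  ztm_linearr (@zt_deg k C M G D T cb z) (unit_ob M) (unit_deg z)
  (fun a b c ab bc e e' X Y Z dZ => zass z e e' (Var X) (Var Y) (z' := Var Z)
    dZ)
  (zass_nat z) _ (zlunit z) (zrunit z) (zlunit_nat z) (zrunit_nat z) _).
- move=> a b c d ab bc cd abc bcd eab ebc ecd eabc eabc' ebcd ebcd' X Y Z W
    dZ dW dZW.
  have := zass_pentagon (z := z) eab ebc ecd eabc eabc' ebcd ebcd' (Var X)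
    (Var Y)
    (v := Var Z) (w := Var W) dZ dW dZW.
  by rewrite /= -!zassP.
move=> a b e e' X Y dY; exact: zass_triangle.
Defined.

End ZestingHomog.

Theorem proposition3p3 (k : closedFieldType) (char0 : [pchar k] =i pred0)
    (G : finGroupType) (C : lincat k) (M : monoidal C) (fusM : fusion M)
    (D : grading G M) (T : right_action D) (c : gbraiding T)
    (z : assoc_zesting_datum c) :
  exists M' : monoidal C,
    bilinear_tensor M' /\
    forall g1 g2 : G,
      exists phi : forall X Y : C, deg D g1 X -> deg D g2 Y ->
          Iso (tens M' X Y) (tens M (tens M X Y) (lam z g1 g2)),
        forall (X X' Y Y' : C) (dX : deg D g1 X) (dX' : deg D g1 X')
            (dY : deg D g2 Y) (dY' : deg D g2 Y')
            (f : Mor X X') (h : Mor Y Y'),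
          phi X' Y' dX' dY' ∘ tensm M' f h
          = tensm M (tensm M f h) (idmor (lam z g1 g2)) ∘ phi X Y dX dY.
Proof.
have [bil ab] := (fus_bilinear fusM, fus_abelian fusM).
have sum (F : G * G -> C) : {S : C & biprod F S}.
  have [S FS] := constructive_indefinite_description _ (ab_sum ab F).
  by exists S; exact: biprod_of_direct_sum.
have dec (X : C) :
    {F : G -> C & ((forall g, deg D g (F g)) * biprod F X)%type}.
  have [F [dF FX]] := constructive_indefinite_description _ (deg_sum D X).
  by exists F; split; last exact: biprod_of_direct_sum.
pose H := zesting_homog z bil.
exists (etens_monoidal H dec sum); split; first exact: etens_bilinear.
move=> g1 g2; exists (fun X Y dX dY => etens_homog H dec sum dX dY).
by move=> X X' Y Y' dX dX' dY dY' f h; apply: etens_homog_nat.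
Qed.
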